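(* Let $R$ be a commutative ring and suppose $J$ is a Jordan $R$-algebra that is isotopic to $\mathrm{Her}_3(C,\Gamma)$ for some composition $R$-algebra $C$ and some diagonal matrix $\Gamma=\langle\gamma_1,\gamma_2,\gamma_3\rangle\in\mathrm{GL}_3(R)$. If $R$ is an LG ring, then $J$ is isomorphic to $\mathrm{Her}_3(C,\Gamma')$ for some diagonal matrix $\Gamma'=\langle\gamma_1',\gamma_2',\gamma_3'\rangle\in\mathrm{GL}_3(R)$.
   Context: LG rings. A commutative ring $R$ is an LG ring if, whenever a polynomial $f\in R[x_1,\dots,x_n]$ represents a unit over $R_{\mathfrak m}$ (i.e. takes a value in $R_{\mathfrak m}^\times$ at some point of $R_{\mathfrak m}^n$) for every maximal ideal $\mathfrak m$ of $R$, then $f$ represents a unit over $R$. (Every semi-local ring is LG.) A quadratic map between $R$-modules is a polynomial law homogeneous of degree 2. Composition algebras. A composition $R$-algebra is a unital, not necessarily associative $R$-algebra $C$, finitely generated projective as an $R$-module, with a quadratic form $n_C$ such that $n_C(xy)=n_C(x)n_C(y)$, $n_C(1_C)=1$, and $n_C(x,y):=n_C(x+y)-n_C(x)-n_C(y)$ induces an isomorphism $C\to C^*$. Put $\mathrm{Tr}_C(x)=n_C(x,1_C)$, $\bar x=\mathrm{Tr}_C(x)1_C-x$. Jordan algebras. A para-quadratic $R$-algebra is an $R$-module $J$ with a quadratic map $U:J\to\mathrm{End}_R(J)$, $x\mapsto U_x$, and $1_J\in J$ with $U_{1_J}=\mathrm{Id}_J$; put $\{xyz\}=(U_{x+z}-U_x-U_z)y$.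 Homomorphisms are $R$-linear maps preserving $1$ and satisfying $\phi(U_xy)=U_{\phi(x)}\phi(y)$. It is a Jordan algebra if $U_{U_xy}=U_xU_yU_x$ and $U_x\{yxz\}=\{(U_xy)zx\}$ hold in $J\otimes S$ for all commutative $R$-algebras $S$. An element $u$ is invertible if $U_u$ is bijective, and then $u^{-1}=U_u^{-1}u$. For invertible $u$, the Jordan algebra $J^{(u)}$ has the same module, $U$-operator $U^{(u)}_x=U_xU_u$, and identity $u^{-1}$. Two Jordan algebras $J,J'$ are isotopic if $J'\cong J^{(u)}$ for some invertible $u\in J$; this is an equivalence relation. Hermitian matrices. For a composition algebra $C$ and diagonal $\Gamma=\langle\gamma_1,\gamma_2,\gamma_3\rangle\in\mathrm{GL}_3(R)$, $\mathrm{Her}_3(C,\Gamma)$ is the $R$-module of matrices $$x=\begin{pmatrix}\alpha_1&\gamma_2c_3&\gamma_3\bar c_2\\ \gamma_1\bar c_3&\alpha_2&\gamma_3c_1\\ \gamma_1c_2&\gamma_2\bar c_1&\alpha_3\end{pmatrix},\quad \alpha_i\in R,\ c_i\in C.$$ With $x$ having coordinates $(\alpha_i,c_i)$ and $y$ coordinates $(\beta_i,d_i)$, indices mod 3, put $T(x,y)=\sum_i(\alpha_i\beta_i+\gamma_{i+1}\gamma_{i+2}n_C(c_i,d_i))$; let $x^\sharp$ have coordinates $(\alpha_{i+1}\alpha_{i+2}-\gamma_{i+1}\gamma_{i+2}n_C(c_i),\ -\alpha_ic_i+\gamma_i\overline{c_{i+1}c_{i+2}})$; $x\times y=(x+y)^\sharp-x^\sharp-y^\sharp$.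 With the identity matrix as identity and $U_xy=T(x,y)x-x^\sharp\times y$, $\mathrm{Her}_3(C,\Gamma)$ is a Jordan algebra. *)

(* Defs.v *)
From HB Require Import structures.
From mathcomp Require Import all_boot all_algebra.
From mathcomp Require Import boolp.
From mathcomp Require Import freeg mpoly.
From mathcomp Require Import ring.
Set Implicit Arguments.
Unset Strict Implicit.
Unset Printing Implicit Defensive.
Import GRing.Theory.
Local Open Scope ring_scope.
Local Open Scope quotient_scope.

Section Localization.
Variables (R : comNzRingType) (P : prime_idealr R).

Definition den := {s : R | s \notin P}.

Lemma den1_subproof : 1 \notin P. Proof. by rewrite idealr1. Qed.
Definition den1 : den := exist _ 1 den1_subproof.

Lemma denM_subproof (s t : den) : sval s * sval t \notin P.
Proof. by rewrite prime_idealrM negb_or (valP s) (valP t). Qed.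
Definition denM s t : den := exist _ (sval s * sval t) (denM_subproof s t).

Lemma denMA s t u : denM s (denM t u) = denM (denM s t) u.
Proof. by apply: val_inj; rewrite /= mulrA. Qed.
Lemma denMC s t : denM s t = denM t s.
Proof. by apply: val_inj; rewrite /= mulrC. Qed.
Lemma denM1 s : denM den1 s = s.
Proof. by apply: val_inj; rewrite /= mul1r. Qed.

Definition loc_eq (x y : R * den) : bool :=
  `[< exists u : den, sval u * (x.1 * sval y.2) = sval u * (y.1 * sval x.2) >].

Lemma loc_eq_equiv : equiv_class_of loc_eq.
Proof.
split=> [x|x y|y x z].
- by apply/asboolP; exists den1.
- by apply/asboolP/asboolP => -[u e]; exists u.
- move=> /asboolP[u e] /asboolP[v f]; apply/asboolP.
  exists (denM (denM u v) y.2) => /=.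
  transitivity (sval v * sval z.2 * (sval u * (x.1 * sval y.2))); first by ring.
  rewrite e.
  transitivity (sval u * sval x.2 * (sval v * (y.1 * sval z.2))); first by ring.
  by rewrite f; ring.
Qed.

Canonical loc_eq_equivRel := EquivRelPack loc_eq_equiv.

Definition loc := {eq_quot loc_eq}.
HB.instance Definition _ : EqQuotient _ loc_eq loc := EqQuotient.on loc.
HB.instance Definition _ := Choice.on loc.

Definition loc_frac (a : R) (s : den) : loc := \pi_loc (a, s).

Lemma loc_fracP a s b t :
  loc_frac a s = loc_frac b t <->
  exists u : den, sval u * (a * sval t) = sval u * (b * sval s).
Proof.
rewrite /loc_frac; split => [/eqmodP/asboolP//|h].
by apply/eqmodP/asboolP.
Qed.

Lemma loc_fracW (T : loc -> Prop) : (forall a s, T (loc_frac a s)) -> forall x, T x.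
Proof. by move=> h x; rewrite -[x]reprK; case: (repr x) => a s; apply: h. Qed.

Definition locD (x y : loc) : loc :=
  loc_frac ((repr x).1 * sval (repr y).2 + (repr y).1 * sval (repr x).2)
       (denM (repr x).2 (repr y).2).
Definition locN (x : loc) : loc := loc_frac (- (repr x).1) (repr x).2.
Definition locM (x y : loc) : loc :=
  loc_frac ((repr x).1 * (repr y).1) (denM (repr x).2 (repr y).2).

Lemma repr_loc_frac a s : exists u : den,
  sval u * ((repr (loc_frac a s)).1 * sval s) = sval u * (a * sval (repr (loc_frac a s)).2).
Proof.
by apply/loc_fracP; rewrite /loc_frac; case: (repr _) (reprK (\pi_loc (a, s))) => ? ? /=.
Qed.

Lemma locDE a s b t :
  locD (loc_frac a s) (loc_frac b t) = loc_frac (a * sval t + b * sval s) (denM s t).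
Proof.
rewrite /locD; apply/loc_fracP.
have [u] := repr_loc_frac a s; have [v] := repr_loc_frac b t.
case: (repr _) => b' t'; case: (repr _) => a' s' /= e f.
exists (denM u v) => /=.
transitivity (sval v * sval t * sval t' * (sval u * (a' * sval s))
  + sval u * sval s * sval s' * (sval v * (b' * sval t))); first by ring.
by rewrite e f; ring.
Qed.

Lemma locNE a s : locN (loc_frac a s) = loc_frac (- a) s.
Proof.
rewrite /locN; apply/loc_fracP.
have [u] := repr_loc_frac a s; case: (repr _) => a' s' /= e.
by exists u; rewrite !mulNr !mulrN e.
Qed.

Lemma locME a s b t : locM (loc_frac a s) (loc_frac b t) = loc_frac (a * b) (denM s t).
Proof.
rewrite /locM; apply/loc_fracP.
have [u] := repr_loc_frac a s; have [v] := repr_loc_frac b t.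
case: (repr _) => b' t'; case: (repr _) => a' s' /= e f.
exists (denM u v) => /=.
transitivity ((sval u * (a' * sval s)) * (sval v * (b' * sval t))); first by ring.
by rewrite e f; ring.
Qed.

Lemma eq_loc_frac a s b t : a * sval t = b * sval s -> loc_frac a s = loc_frac b t.
Proof. by move=> e; apply/loc_fracP; exists den1; rewrite e. Qed.

Lemma locDA : associative locD.
Proof.
elim/loc_fracW=> a s; elim/loc_fracW=> b t; elim/loc_fracW=> c u.
by rewrite !locDE; apply: eq_loc_frac => /=; ring.
Qed.
Lemma locDC : commutative locD.
Proof.
elim/loc_fracW=> a s; elim/loc_fracW=> b t.
by rewrite !locDE; apply: eq_loc_frac => /=; ring.
Qed.
Lemma loc0D : left_id (loc_frac 0 den1) locD.
Proof. by elim/loc_fracW=> a s; rewrite !locDE; apply: eq_loc_frac => /=; ring. Qed.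
Lemma locND : left_inverse (loc_frac 0 den1) locN locD.
Proof. by elim/loc_fracW=> a s; rewrite locNE locDE; apply: eq_loc_frac => /=; ring. Qed.
HB.instance Definition _ := GRing.isZmodule.Build loc locDA locDC loc0D locND.

Lemma locMA : associative locM.
Proof.
elim/loc_fracW=> a s; elim/loc_fracW=> b t; elim/loc_fracW=> c u.
by rewrite !locME; apply: eq_loc_frac => /=; ring.
Qed.
Lemma locMC : commutative locM.
Proof.
elim/loc_fracW=> a s; elim/loc_fracW=> b t.
by rewrite !locME; apply: eq_loc_frac => /=; ring.
Qed.
Lemma loc1M : left_id (loc_frac 1 den1) locM.
Proof. by elim/loc_fracW=> a s; rewrite !locME; apply: eq_loc_frac => /=; ring. Qed.
Lemma locMDl : left_distributive locM locD.
Proof.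
elim/loc_fracW=> a s; elim/loc_fracW=> b t; elim/loc_fracW=> c u.
by rewrite !(locDE, locME); apply: eq_loc_frac => /=; ring.
Qed.
Lemma loc1_neq0 : loc_frac 1 den1 != loc_frac 0 den1.
Proof.
apply/eqP => /loc_fracP[u] /=; rewrite !mulr1 mulr0 => u0.
by have := valP u; rewrite /= u0 rpred0.
Qed.
HB.instance Definition _ :=
  GRing.Zmodule_isComNzRing.Build loc locMA locMC loc1M locMDl loc1_neq0.

Definition loc_unit : {pred loc} := [pred x | `[< exists y : loc, y * x = 1 >]].
Definition loc_inv (x : loc) : loc :=
  if pselect (exists y : loc, y * x = 1) is left e then sval (cid e) else x.
Lemma loc_mulVr : {in loc_unit, left_inverse 1 loc_inv *%R}.
Proof.
move=> x /asboolP xu; rewrite /loc_inv; case: pselect => // e.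
by case: cid.
Qed.
Lemma loc_unitP x y : y * x = 1 -> loc_unit x.
Proof. by move=> e; apply/asboolP; exists y. Qed.
Lemma loc_inv_out : {in [predC loc_unit], loc_inv =1 id}.
Proof.
move=> x /=; rewrite inE => /asboolP xu; rewrite /loc_inv.
by case: pselect.
Qed.
HB.instance Definition _ :=
  GRing.ComNzRing_hasMulInverse.Build loc loc_mulVr loc_unitP loc_inv_out.

Definition to_loc (a : R) : loc := loc_frac a den1.
Lemma to_loc_additive : zmod_morphism to_loc.
Proof.
move=> a b; rewrite -[RHS]/(locD (loc_frac a den1) (locN (loc_frac b den1))).
by rewrite locNE locDE; apply: eq_loc_frac => /=; ring.
Qed.
Lemma to_loc_monoid : monoid_morphism to_loc.
Proof.
split=> // a b; rewrite -[RHS]/(locM (loc_frac a den1) (loc_frac b den1)).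
by rewrite locME; apply: eq_loc_frac => /=; ring.
Qed.
HB.instance Definition _ := GRing.isZmodMorphism.Build R loc to_loc to_loc_additive.
HB.instance Definition _ := GRing.isMonoidMorphism.Build R loc to_loc to_loc_monoid.
End Localization.

(* M (x)_R S, as the free S-module on M modulo the S-submodule generated by the
   [m + m'] - [m] - [m'] and the [a m] - a [m]. *)
Section TensorProduct.
Variables (R : comNzRingType) (M : lmodType R) (S : comAlgType R).
Local Notation free := {freeg M / S}.

Definition trel : {pred free} := [pred D : free | `[< forall H : {pred free},
  submod_closed H ->
  (forall m m' : M, << m + m' >> - << m >> - << m' >> \in H) ->
  (forall (a : R) (m : M), << a *: m >> - a%:A *: << m >> \in H) ->
  D \in H >] ].

Lemma trel_submod : submod_closed trel.
Proof.
split; first by apply/asboolP => H [].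
move=> s D D' /asboolP hD /asboolP hD'; apply/asboolP => H Hs HD HZ.
by case: (Hs) => _; apply; [apply: hD | apply: hD'].
Qed.
HB.instance Definition _ := GRing.isSubmodClosed.Build S free trel trel_submod.

Definition tensor : Type := {ideal_quot trel}.
HB.instance Definition _ := GRing.Zmodule.on tensor.
HB.instance Definition _ : EqQuotient _ (Quotient.equiv trel) tensor :=
  EqQuotient.on tensor.

Definition tscale (s : S) (x : tensor) : tensor := \pi_tensor (s *: repr x).

Lemma tensor_eqP (D D' : free) :
  \pi_tensor D = \pi_tensor D' <-> D - D' \in trel.
Proof. by rewrite Quotient.idealrBE; split => [->|/eqP]. Qed.

Lemma pi_tensorD (D D' : free) :
  \pi_tensor (D + D') = \pi_tensor D + \pi_tensor D' :> tensor.
Proof. by rewrite !piE. Qed.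

Lemma pi_tensor0 : \pi_tensor 0 = 0 :> tensor.
Proof. by apply: (@addrI _ (\pi_tensor 0)); rewrite -pi_tensorD !addr0. Qed.

Lemma tscaleE s (D : free) : tscale s (\pi_tensor D) = \pi_tensor (s *: D).
Proof.
apply/tensor_eqP; rewrite -scalerBr; apply: rpredZ.
by apply/tensor_eqP; rewrite reprK.
Qed.

Lemma tensorW (Q : tensor -> Prop) :
  (forall D : free, Q (\pi_tensor D)) -> forall x, Q x.
Proof. by move=> h x; rewrite -[x]reprK. Qed.

Fact tscaleA s t x : tscale s (tscale t x) = tscale (s * t) x.
Proof. by elim/tensorW: x => D; rewrite !tscaleE scalerA. Qed.
Fact tscale1 : left_id 1 tscale.
Proof. by elim/tensorW=> D; rewrite tscaleE scale1r. Qed.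
Fact tscaleDr : right_distributive tscale +%R.
Proof.
move=> s; elim/tensorW=> D; elim/tensorW=> D'.
by rewrite -pi_tensorD !tscaleE scalerDr pi_tensorD.
Qed.
Fact tscaleDl x : {morph tscale^~ x : s t / s + t}.
Proof.
move=> s t; elim/tensorW: x => D.
by rewrite !tscaleE scalerDl pi_tensorD.
Qed.
HB.instance Definition _ := GRing.Zmodule_isLmodule.Build S tensor
  tscaleA tscale1 tscaleDr tscaleDl.

Definition tens (m : M) (s : S) : tensor := \pi_tensor (<< s *g m >>).

Lemma tensZ (t : S) m s : t *: tens m s = tens m (t * s).
Proof.
rewrite -[LHS]/(tscale t (tens m s)) tscaleE; congr (\pi_tensor _).
by apply/eqP/freeg_eqP => k; rewrite coeffZ !coeffU mulrA.
Qed.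

Lemma tensDr m s t : tens m (s + t) = tens m s + tens m t.
Proof. by rewrite /tens -pi_tensorD freegUD. Qed.

Lemma tensDl m m' s : tens (m + m') s = tens m s + tens m' s.
Proof.
rewrite -[s]mulr1 -!tensZ -scalerDr; congr (_ *: _).
rewrite /tens -pi_tensorD; apply/tensor_eqP/asboolP => H _ HD _.
by rewrite opprD addrA; apply: HD.
Qed.

Lemma tensZl (a : R) m s : tens (a *: m) s = tens m (a *: s).
Proof.
rewrite -[s in LHS]mulr1 -[a *: s]mulr_algl -[_ * s]mulrC.
rewrite -!tensZ; congr (_ *: _); rewrite -[a%:A]mulr1 -tensZ.
rewrite -[RHS]/(tscale a%:A (tens m 1)) tscaleE.
by apply/tensor_eqP/asboolP => H _ _; apply.
Qed.

Lemma tensor_ind (Q : tensor -> Prop) :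
  (forall m s, Q (tens m s)) -> (forall x y, Q x -> Q y -> Q (x + y)) ->
  forall x, Q x.
Proof.
move=> Qt QD; have Q0 : Q 0.
  by rewrite -pi_tensor0 -(freegU0 _ (0 : M)); apply: Qt.
elim/tensorW => D; rewrite -[D]freeg_sumE.
elim: (dom D) => [|m r IH]; first by rewrite big_nil pi_tensor0.
by rewrite big_cons pi_tensorD; apply: QD; [apply: Qt | apply: IH].
Qed.

Section Lift.
Variables (A : zmodType) (f : M -> S -> A).

(* The additive map m (x) s |-> f m s; meaningful for balanced biadditive f. *)
Definition tlift (x : tensor) : A :=
  \sum_(m <- dom (repr x)) f m (coeff m (repr x)).

Hypothesis fDl : forall m m' s, f (m + m') s = f m s + f m' s.
Hypothesis fDr : forall m s t, f m (s + t) = f m s + f m t.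
Hypothesis fZ : forall a m s, f (a *: m) s = f m (a *: s).

Let ev (D : free) : A := \sum_(m <- dom D) f m (coeff m D).

Let f0 m : f m 0 = 0.
Proof. by apply: (@addrI _ (f m 0)); rewrite -fDr !addr0. Qed.

Let evE (r : seq M) (D : free) : uniq r -> {subset dom D <= r} ->
  ev D = \sum_(m <- r) f m (coeff m D).
Proof.
move=> ur sr; rewrite /ev [RHS](bigID (fun m => m \in dom D)) /=.
rewrite [X in _ + X]big1 ?addr0 => [|m mD]; last by rewrite coeff_outdom.
rewrite -[RHS]big_filter; apply: perm_big; apply: uniq_perm.
- exact: uniq_dom.
- exact: filter_uniq.
- move=> m; rewrite mem_filter; case mD: (m \in dom D) => //=.
  by rewrite sr.
Qed.

Let evD D D' : ev (D + D') = ev D + ev D'.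
Proof.
pose r := undup (dom D ++ dom D').
have ur : uniq r by exact: undup_uniq.
have sD : {subset dom D <= r} by move=> m h; rewrite mem_undup mem_cat h.
have sD' : {subset dom D' <= r}.
  by move=> m h; rewrite mem_undup mem_cat h orbT.
have sDD' : {subset dom (D + D') <= r}.
  by move=> m /domD_subset h; rewrite mem_undup.
rewrite (evE ur sD) (evE ur sD') (evE ur sDD') -big_split /=.
by apply: eq_bigr => m _; rewrite coeffD fDr.
Qed.

Let evN D : ev (- D) = - ev D.
Proof.
apply: (@addrI _ (ev D)); rewrite -evD !subrr /ev big1 // => m _.
by rewrite coeff0.
Qed.

Let evU s m : ev << s *g m >> = f m s.
Proof.
have [->|sn0] := eqVneq s 0.
  by rewrite f0 freegU0 /ev big1 // => k _; rewrite coeff0.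
by rewrite /ev domU // big_seq1 coeffU eqxx mulr1.
Qed.

Let evZU t s m : ev (t *: << s *g m >>) = f m (t * s).
Proof.
rewrite -evU; congr ev; apply/eqP/freeg_eqP => k.
by rewrite coeffZ !coeffU mulrA.
Qed.

Let ev_rel D : D \in trel -> ev D = 0.
Proof.
move/asboolP => /(_ [pred D | `[< forall t : S, ev (t *: D) = 0 >] ]) h.
suff /asboolP/(_ 1) : D \in [pred D | `[< forall t : S, ev (t *: D) = 0 >] ].
  by rewrite scale1r.
apply: h.
- split; first by apply/asboolP => t; rewrite scaler0 /ev big1 // => k _; rewrite coeff0.
  move=> s E E' /asboolP hE /asboolP hE'; apply/asboolP => t.
  by rewrite scalerDr scalerA evD hE hE' addr0.
- move=> m m'; apply/asboolP => t.
  by rewrite !scalerBr !evD !evN !evZU mulr1 fDl addrAC addrK subrr.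
- move=> a m; apply/asboolP => t.
  by rewrite scalerBr scalerA evD evN !evZU !mulr1 fZ mulr_algr subrr.
Qed.

Let tliftE D : tlift (\pi_tensor D) = ev D.
Proof.
apply/eqP; rewrite -subr_eq0 -[tlift _]/(ev (repr (\pi_tensor D))).
rewrite -evN -evD; apply/eqP/ev_rel/tensor_eqP.
by rewrite reprK.
Qed.

Lemma tlift_tens m s : tlift (tens m s) = f m s.
Proof. by rewrite tliftE evU. Qed.

Lemma tliftD x y : tlift (x + y) = tlift x + tlift y.
Proof.
elim/tensorW: x => D; elim/tensorW: y => D'.
by rewrite -pi_tensorD !tliftE evD.
Qed.

End Lift.
End TensorProduct.
Arguments tens {R M S} m s.
Arguments tlift {R M S A} f x.

Section EndModule.
Variables (R : comNzRingType) (M : lmodType R).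

Definition Endo : Type := {linear M -> M}.
HB.instance Definition _ := gen_eqMixin Endo.
HB.instance Definition _ := gen_choiceMixin Endo.
Implicit Types f g h : Endo.

Lemma EndP f g : (forall x, f x = g x) -> f = g.
Proof.
case: f => f [[fD] [fZ]]; case: g => g [[gD] [gZ]] /= /funext fg.
case: _ / fg in gD gZ *.
by rewrite (Prop_irrelevance gD fD) (Prop_irrelevance gZ fZ).
Qed.

Definition End0 : Endo := \0.
Definition EndN f : Endo := \- f.
Definition EndD f g : Endo := f \+ g.
Definition EndZ (a : R) f : Endo := a \*: f.

Fact EndDA : associative EndD.
Proof. by move=> f g h; apply: EndP => x /=; rewrite addrA. Qed.
Fact EndDC : commutative EndD.
Proof. by move=> f g; apply: EndP => x /=; rewrite addrC. Qed.
Fact End0D : left_id End0 EndD.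
Proof. by move=> f; apply: EndP => x /=; rewrite add0r. Qed.
Fact EndND : left_inverse End0 EndN EndD.
Proof. by move=> f; apply: EndP => x /=; rewrite addNr. Qed.
HB.instance Definition _ := GRing.isZmodule.Build Endo EndDA EndDC End0D EndND.

Fact EndZA a b f : EndZ a (EndZ b f) = EndZ (a * b) f.
Proof. by apply: EndP => x /=; rewrite scalerA. Qed.
Fact End1Z : left_id 1 EndZ.
Proof. by move=> f; apply: EndP => x /=; rewrite scale1r. Qed.
Fact EndZDr : right_distributive EndZ +%R.
Proof. by move=> a f g; apply: EndP => x /=; rewrite scalerDr. Qed.
Fact EndZDl f : {morph EndZ^~ f : a b / a + b}.
Proof. by move=> a b; apply: EndP => x /=; rewrite scalerDl. Qed.
HB.instance Definition _ :=
  GRing.Zmodule_isLmodule.Build R Endo EndZA End1Z EndZDr EndZDl.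
End EndModule.

Section LGRing.
Variable R : comUnitRingType.

Definition represents_unit (A : comUnitRingType) n (f : {mpoly A[n]}) : Prop :=
  exists v : 'I_n -> A, f.@[v] \is a GRing.unit.

Definition maximal_ideal (P : prime_idealr R) : Prop :=
  forall I : idealr R, {subset P <= I} -> {subset I <= P}.

(* A maximal ideal is prime, so it is no restriction to quantify over prime
   ideals first; [prime_idealr] is what makes [loc P] a ring. *)
Definition LG : Prop :=
  forall n (f : {mpoly R[n]}),
    (forall P : prime_idealr R, maximal_ideal P ->
       represents_unit (map_mpoly (to_loc P) f)) ->
    represents_unit f.
End LGRing.

Section PolynomialLaws.
Variable R : comNzRingType.
Implicit Types (M N : lmodType R) (S : comAlgType R).

Definition tbase M S S' (phi : {lrmorphism S -> S'}) : tensor M S -> tensor M S' :=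
  tlift (fun m s => tens m (phi s)).

Record polyLaw M N := PolyLaw {
  law_fun :> forall S, tensor M S -> tensor N S;
  law_natural : forall S S' (phi : {lrmorphism S -> S'}) (x : tensor M S),
    law_fun (tbase phi x) = tbase phi (law_fun x) }.

Definition law_homogeneous M N (d : nat) (F : polyLaw M N) : Prop :=
  forall S (s : S) (x : tensor M S), F S (s *: x) = s ^+ d *: F S x.

(* The canonical isomorphism N (x) R -> N. *)
Definition tunit N : tensor N R^o -> N := tlift (fun n (a : R^o) => (a : R) *: n).

(* The map M -> N underlying a polynomial law. *)
Definition law_map M N (F : polyLaw M N) (x : M) : N :=
  tunit (F R^o (tens x 1)).

(* Endo(M) (x) S acting on M (x) S: (phi (x) s)(m (x) t) = phi(m) (x) st. *)
Definition tact M S (w : tensor (Endo M) S) (x : tensor M S) : tensor M S :=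
  tlift (fun (phi : Endo M) s => tlift (fun m t => tens (phi m) (s * t)) x) w.

Lemma tunit_tens N (n : N) (a : R) : tunit (tens n (a : R^o)) = a *: n.
Proof.
rewrite /tunit tlift_tens //.
- by move=> m m' s; rewrite scalerDr.
- by move=> m s t; rewrite scalerDl.
- by move=> b m s; rewrite scalerA mulrC.
Qed.

Lemma tbase_tens M S S' (phi : {lrmorphism S -> S'}) (m : M) s :
  tbase phi (tens m s) = tens m (phi s).
Proof.
rewrite /tbase tlift_tens //.
- by move=> *; rewrite tensDl.
- by move=> *; rewrite rmorphD tensDr.
- by move=> *; rewrite tensZl linearZ.
Qed.

Lemma tact_tens M S (phi : Endo M) s (m : M) (t : S) :
  tact (tens phi s) (tens m t) = tens (phi m) (s * t).
Proof.
have inner (f : Endo M) (r : S) m' r' :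
    tlift (fun m0 t0 => tens (f m0) (r * t0)) (tens m' r') = tens (f m') (r * r').
  rewrite tlift_tens //.
  - by move=> *; rewrite linearD tensDl.
  - by move=> *; rewrite mulrDr tensDr.
  - by move=> a *; rewrite linearZ tensZl scalerAr.
rewrite /tact tlift_tens ?inner //.
- by move=> *; rewrite !inner tensDl.
- by move=> *; rewrite !inner mulrDl tensDr.
- by move=> *; rewrite !inner tensZl scalerAl.
Qed.
End PolynomialLaws.

Section CompositionAlgebras.
Variable R : comNzRingType.

Definition fin_gen (M : lmodType R) : Prop :=
  exists n (e : 'I_n -> M),
    forall x, exists a : 'I_n -> R, x = \sum_i a i *: e i.

Definition projective (P : lmodType R) : Prop :=
  forall (M N : lmodType R) (g : {linear M -> N}) (h : {linear P -> N}),
    (forall y, exists x, g x = y) ->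
    exists k : {linear P -> M}, forall p, g (k p) = h p.

Definition polar (M : lmodType R) (q : polyLaw M R^o) (x y : M) : R :=
  law_map q (x + y) - law_map q x - law_map q y.

(* [ca_norm_regular]: x |-> n(x, -) is a bijection from C to its dual. *)
Record compAlg := CompAlg {
  ca_mod :> lmodType R;
  ca_mul : {bilinear ca_mod -> ca_mod -> ca_mod};
  ca_one : ca_mod;
  ca_norm : polyLaw ca_mod R^o;
  ca_fin_gen : fin_gen ca_mod;
  ca_projective : projective ca_mod;
  ca_mul1l : left_id ca_one ca_mul;
  ca_mul1r : right_id ca_one ca_mul;
  ca_norm_quadratic : law_homogeneous 2 ca_norm;
  ca_normM : forall x y,
    law_map ca_norm (ca_mul x y) =
      (law_map ca_norm x : R) * law_map ca_norm y :> R;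
  ca_norm1 : law_map ca_norm ca_one = 1 :> R;
  ca_norm_regular : forall phi : {linear ca_mod -> R^o},
    exists! x, forall y, phi y = polar ca_norm x y }.

Variable C : compAlg.
Definition ca_n (x : C) : R := law_map (ca_norm C) x.
Definition ca_n2 (x y : C) : R := polar (ca_norm C) x y.
Definition ca_trace (x : C) : R := ca_n2 x (ca_one C).
Definition ca_conj (x : C) : C := ca_trace x *: ca_one C - x.
End CompositionAlgebras.

Section ParaQuadratic.
Variable R : comNzRingType.

(* The data of a para-quadratic algebra at the level of R, which is all that
   homomorphisms, isotopes and isotopy depend on. *)
Record uAlg := UAlg {
  ua_mod :> lmodType R;
  ua_U : ua_mod -> ua_mod -> ua_mod;
  ua_one : ua_mod }.

Record paraQuad := ParaQuad {
  pq_mod : lmodType R;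
  pq_U : polyLaw pq_mod (Endo pq_mod);
  pq_one : pq_mod;
  pq_quadratic : law_homogeneous 2 pq_U;
  pq_U1 : forall x, law_map pq_U pq_one x = x }.

Definition pq_uAlg (J : paraQuad) : uAlg :=
  @UAlg (pq_mod J) (fun x y => law_map (pq_U J) x y) (pq_one J).

Definition jordan (J : paraQuad) : Prop :=
  forall (S : comAlgType R) (x y z : tensor (pq_mod J) S),
    let U a b := tact (pq_U J S a) b in
    let triple a b c := U (a + c) b - U a b - U c b in
    U (U x y) z = U x (U y (U x z)) /\
    U x (triple y x z) = triple (U x y) z x.

Definition isomorphic (J J' : uAlg) : Prop :=
  exists phi : {linear J -> J'},
    [/\ bijective phi, phi (ua_one J) = ua_one J'
      & forall x y, phi (ua_U x y) = ua_U (phi x) (phi y)].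

Definition invertible (J : uAlg) (u : J) : Prop := bijective (ua_U u).

(* U_u^{-1} u; the value is junk when u has no preimage under U_u. *)
Definition ua_inv (J : uAlg) (u : J) : J :=
  if pselect (exists v, ua_U u v = u) is left e then sval (cid e) else u.

Definition isotope (J : uAlg) (u : J) : uAlg :=
  @UAlg J (fun x y => ua_U x (ua_U u y)) (ua_inv u).

Definition isotopic (J J' : uAlg) : Prop :=
  exists u : J, invertible u /\ isomorphic J' (isotope u).
End ParaQuadratic.
Coercion pq_uAlg : paraQuad >-> uAlg.

(* Her_3(C, G) for a diagonal matrix G with diagonal g.  The hermitian matrix
   with coordinates (alpha_i, c_i) has alpha_i in position (i, i),
   g_(i+1) c_(i+2) in position (i, i+1) and g_i conj(c_(i+2)) in position
   (i+1, i), the indices 1, 2, 3 being 0, 1, 2 in 'I_3, whose ring structure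
   is that of Z/3.  When G is invertible this identifies the module of
   hermitian matrices with that of the coordinates, used as carrier. *)
Section Hermitian.
Variables (R : comNzRingType) (C : compAlg R) (G : 'M[R]_3).

Definition her_mod : lmodType R :=
  ({ffun 'I_3 -> R^o} * {ffun 'I_3 -> C})%type.

Definition her_diag (x : her_mod) (i : 'I_3) : R := x.1 i.
Definition her_off (x : her_mod) (i : 'I_3) : C := x.2 i.
Local Notation g i := (G i i).

Definition her_one : her_mod := ([ffun=> 1], [ffun=> 0]).

Definition her_T (x y : her_mod) : R :=
  \sum_i (her_diag x i * her_diag y i
          + g (i + 1) * g (i + 2) * ca_n2 (her_off x i) (her_off y i)).

Definition her_sharp (x : her_mod) : her_mod :=
  ([ffun i => her_diag x (i + 1) * her_diag x (i + 2)
              - g (i + 1) * g (i + 2) * ca_n (her_off x i)],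
   [ffun i => - (her_diag x i *: her_off x i)
              + g i *: ca_conj (ca_mul C (her_off x (i + 1)) (her_off x (i + 2)))]).

Definition her_cross (x y : her_mod) : her_mod :=
  her_sharp (x + y) - her_sharp x - her_sharp y.

Definition Her3 : uAlg R :=
  @UAlg R her_mod
    (fun x y => her_T x y *: x - her_cross (her_sharp x) y) her_one.
End Hermitian.

(* Main.v *)
Require Import Defs.
From HB Require Import structures.
From mathcomp Require Import all_boot all_order all_algebra.
From mathcomp Require Import boolp freeg mpoly ring.
Set Implicit Arguments.
Unset Strict Implicit.
Unset Printing Implicit Defensive.
Import GRing.Theory.
Local Open Scope ring_scope.

(** Passing to the isotope at a well-chosen element undoes the given isotopy:
    [J] is isomorphic to the isotope of [H = Her_3(C, Gamma)] at some [v] with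
    [U_v] onto ([jordan_her_isotope]).  It remains to see that such an isotope
    is again of the form [Her_3(C, Gamma')].

    If [v] is diagonal with entries [d_i], the [d_i] are units and
    [(alpha_i, c_i) |-> (d_i^-1 alpha_i, c_i)] maps [Her_3(C, Gamma d)] onto the
    isotope ([diagonal_isotope_hermitian]).  A general [v] is diagonalized like
    a hermitian form.  Adding a multiple of one row of a hermitian matrix to
    another, together with the adjoint column operation, is a linear bijection
    that preserves the norm structure of [H]: the trace form is preserved up to
    the opposite operation, and so is the adjoint.  As [U] is built from these
    two ([her_U_similarity]), the isotope does not change, up to isomorphism,
    when a transvection is applied to [v].  For octonions these row operations
    are not matrix multiplications, so they are written in coordinates, and
    the two invariances are checked from the identities
    [x^ (x y) = n(x) y = (y x) x^] and [n(xy, z) = n(y, x^ z)], with [x^] the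
    conjugate, all of which follow from multiplicativity and regularity of [n].

    Clearing a row by transvections needs a unit on the diagonal, and here the
    LG property enters. The diagonal entry obtained by adding multiples [a],
    [a'] of the other two rows is a polynomial in the coordinates of [a] and
    [a'], because the norm is a polynomial law ([law_polyE]). If all its
    values lay in a prime ideal [P], then so would the entry itself, and
    comparing quadratic and linear parts the corresponding off-diagonal
    entries would vanish modulo [P]; then [U_v] could not reach [1] modulo [P]
    ([row_not_in_prime]). So the polynomial represents a unit locally, hence
    over [R] ([exists_unit_row]). Once that row is cleared, the same argument
    handles the remaining 2 by 2 block ([exists_unit_block]), and the last
    diagonal entry is a unit because [U_v] is onto. *)

(** * Scalar quadratic laws are polynomials in the coordinates *)

Section TensorBase.
Variables (R : comNzRingType) (M : lmodType R).

Lemma tens0r (S : comAlgType R) (m : M) : tens m (0 : S) = 0.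
Proof. by apply: (@addrI _ (tens m 0)); rewrite -tensDr !addr0. Qed.

Lemma tbaseD (S S' : comAlgType R) (phi : {lrmorphism S -> S'}) (x y : tensor M S) :
  tbase phi (x + y) = tbase phi x + tbase phi y.
Proof.
apply: tliftD => *; first exact: tensDl.
- by rewrite rmorphD tensDr.
- by rewrite tensZl linearZ.
Qed.

Lemma tbase_sum (S S' : comAlgType R) (phi : {lrmorphism S -> S'}) n
    (m : 'I_n -> M) (s : 'I_n -> S) :
  tbase phi (\sum_i tens (m i) (s i)) = \sum_i tens (m i) (phi (s i)).
Proof.
have tb0 : tbase phi (0 : tensor M S) = 0.
  by rewrite -(tens0r S 0) tbase_tens rmorph0 tens0r.
rewrite (big_morph (tbase phi) (tbaseD phi) tb0).
by apply: eq_bigr => i _; rewrite tbase_tens.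
Qed.

Lemma tunitD (x y : tensor M R^o) : tunit (x + y) = tunit x + tunit y.
Proof.
apply: tliftD => *; [exact: scalerDr | exact: scalerDl |].
by rewrite scalerA mulrC.
Qed.

(** Every element of [M (x) R] is a pure tensor, so a law and its underlying
    map determine each other on [R]-points. *)
Lemma tensor_unitE (x : tensor M R^o) : x = tens (tunit x) 1.
Proof.
elim/tensor_ind: x => [m s|x y ex ey].
  by rewrite tunit_tens tensZl; congr tens; rewrite -[LHS]mulr1.
by rewrite {1}ex {1}ey -tensDl tunitD.
Qed.

End TensorBase.

Section LawPolynomial.
Variable R : comNzRingType.

(** The multiplication isomorphism from [R (x) S] to [S]: it turns the values
    of a scalar polynomial law into honest elements of [S]. *)
Definition tscalar (S : comAlgType R) (x : tensor R^o S) : S :=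
  tlift (fun (a : R^o) (s : S) => (a : R) *: s) x.

Lemma tscalar_tens (S : comAlgType R) (a : R^o) (s : S) :
  tscalar (tens a s) = (a : R) *: s.
Proof.
apply: tlift_tens => *; [exact: scalerDl | exact: scalerDr |].
by rewrite [RHS]scalerA mulrC.
Qed.

Lemma tscalarD (S : comAlgType R) (x y : tensor R^o S) :
  tscalar (x + y) = tscalar x + tscalar y.
Proof.
apply: tliftD => *; [exact: scalerDl | exact: scalerDr |].
by rewrite [RHS]scalerA mulrC.
Qed.

Lemma tscalarZ (S : comAlgType R) (s : S) (x : tensor R^o S) :
  tscalar (s *: x) = s * tscalar x.
Proof.
elim/tensor_ind: x => [a t|x y ex ey].
  by rewrite tensZ !tscalar_tens scalerAr.
by rewrite scalerDr !tscalarD ex ey mulrDr.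
Qed.

Lemma tscalar_base (S S' : comAlgType R) (phi : {lrmorphism S -> S'})
    (x : tensor R^o S) :
  tscalar (tbase phi x) = phi (tscalar x).
Proof.
elim/tensor_ind: x => [a t|x y ex ey].
  by rewrite tbase_tens !tscalar_tens linearZ.
by rewrite tbaseD !tscalarD ex ey rmorphD.
Qed.

Lemma tscalar_unit (x : tensor R^o R^o) : tscalar x = tunit x.
Proof.
elim/tensor_ind: x => [a s|x y ex ey]; last by rewrite tscalarD tunitD ex ey.
by rewrite tscalar_tens tunit_tens; apply: mulrC.
Qed.

Variables (M : lmodType R) (F : polyLaw M R^o).

(** Evaluation with values in the regular algebra [R^o], the form in which [R]
    serves as a scalar extension of itself. *)
Definition meval_alg n (v : 'I_n -> R) (p : {mpoly R[n]}) : R^o := p.@[v].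
HB.instance Definition _ n (v : 'I_n -> R) :=
  GRing.RMorphism.copy (meval_alg v) (meval v).
Fact meval_alg_scalable n (v : 'I_n -> R) : scalable (meval_alg v).
Proof. by move=> a p; apply: mevalZ. Qed.
HB.instance Definition _ n (v : 'I_n -> R) :=
  GRing.isScalable.Build R {mpoly R[n]} R^o _ (meval_alg v)
    (meval_alg_scalable v).

Section Generic.
Variables (n : nat) (e : 'I_n -> M).

(** The value of the law at the generic element of the span of the [e_i], of
    which all its other values there are specializations. *)
Definition law_poly : {mpoly R[n]} :=
  tscalar (F {mpoly R[n]} (\sum_i tens (e i) 'X_i)).

Lemma tens_sum (S : comAlgType R) (a : 'I_n -> R) :
  tens (\sum_i a i *: e i) (1 : S) = \sum_i tens (e i) (a i *: 1).
Proof.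
have t0 : tens (0 : M) (1 : S) = 0.
  by apply: (@addrI _ (tens 0 1)); rewrite -tensDl !addr0.
rewrite (big_morph (fun m => tens m (1 : S)) (fun x y => tensDl x y 1) t0).
by apply: eq_bigr => i _; rewrite tensZl.
Qed.

(** Naturality along [X_i |-> v_i]. *)
Lemma law_polyE (v : 'I_n -> R) :
  law_map F (\sum_i v i *: e i) = law_poly.@[v] :> R.
Proof.
rewrite /law_map -tscalar_unit tens_sum.
have -> : \sum_i tens (e i) (v i *: (1 : R^o)) =
    tbase (meval_alg v) (\sum_i tens (e i) 'X_i).
  rewrite tbase_sum; apply: eq_bigr => i _; congr tens.
  by rewrite /= /meval_alg mevalXU; apply: mulr1.
by rewrite law_natural tscalar_base.
Qed.

Lemma law_poly_comp k (lq : n.-tuple {mpoly R[k]}) :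
  law_poly \mPo lq = tscalar (F _ (\sum_i tens (e i) (tnth lq i))).
Proof.
rewrite -[_ \mPo _]tscalar_base -law_natural tbase_sum.
congr (tscalar (F _ _)); apply: eq_bigr => i _.
by congr tens; rewrite /= comp_mpolyXU -tnth_nth.
Qed.

Hypothesis F2 : law_homogeneous 2 F.

(** Homogeneity over [R[X_1..X_n, T]] gives [p(T X) = T^2 p(X)]; comparing
    the coefficients of powers of [T] kills every monomial of degree other than
    two. *)
Lemma law_poly_homog : law_poly \is 2.-homog.
Proof.
pose Y (i : 'I_n) : {mpoly R[n.+1]} := 'X_(widen_ord (leqnSn n) i).
pose T : {mpoly R[n.+1]} := 'X_ord_max.
have key : law_poly \mPo [tuple T * Y i | i < n] =
    T ^+ 2 * (law_poly \mPo [tuple Y i | i < n]).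
  rewrite !law_poly_comp -tscalarZ -F2 scaler_sumr.
  congr (tscalar (F _ _)); apply: eq_bigr => i _.
  by rewrite tensZ !tnth_mktuple.
have mY i : muni (Y i) = ('X_i)%:P.
  rewrite muniE msuppX big_seq1 mcoeffX eqxx scale1r mnmE.
  have -> : (widen_ord (leqnSn n) i == ord_max) = false.
    by apply/negbTE; rewrite -val_eqE /= neq_ltn ltn_ord.
  rewrite expr0 alg_polyC; congr ('X_[_])%:P.
  by apply/mnmP => j; rewrite !mnmE.
have mT : muni T = 'X.
  rewrite muniE msuppX big_seq1 mcoeffX eqxx scale1r mnmE eqxx expr1.
  have -> : [multinom U_(ord_max)%MM (widen_ord (leqnSn n) j) | j < n] = 0%MM.
    apply/mnmP => j; rewrite !mnmE; apply/eqP; rewrite eqb0 -val_eqE /=.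
    by rewrite neq_ltn ltn_ord orbT.
  by rewrite mpolyX0 scale1r.
have c1 (m : 'X_{1..n}) : muni ('X_[m] \mPo [tuple Y i | i < n]) = ('X_[m])%:P.
  rewrite comp_mpolyX rmorph_prod mpolyXE_id rmorph_prod; apply: eq_bigr => i _.
  by rewrite !rmorphXn /= tnth_mktuple mY.
have c2 (m : 'X_{1..n}) : muni ('X_[m] \mPo [tuple T * Y i | i < n]) =
    ('X_[m])%:P * 'X^(mdeg m).
  rewrite comp_mpolyX rmorph_prod mpolyXE_id rmorph_prod mdegE.
  rewrite -prodrXr -big_split /=; apply: eq_bigr => i _.
  by rewrite !rmorphXn /= tnth_mktuple rmorphM /= mY mT exprMn mulrC.
(* [raddf_sum] alone would unfold the composition to its defining sum. *)
have compE k (p : {mpoly R[n]}) (lq : n.-tuple {mpoly R[k]}) :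
    p \mPo lq = \sum_(m <- msupp p) p@_m *: ('X_[m] \mPo lq).
  rewrite {1}[p]mpolyE [LHS](raddf_sum (comp_mpoly lq)).
  by apply: eq_bigr => m _; rewrite /= comp_mpolyZ.
have m1 : muni (law_poly \mPo [tuple Y i | i < n]) = law_poly%:P.
  rewrite [in RHS](mpolyE law_poly) compE !raddf_sum.
  apply: eq_bigr => m _ /=.
  by rewrite muniZ c1 -mul_mpolyC polyCM mul_polyC.
have m2 : muni (law_poly \mPo [tuple T * Y i | i < n]) =
    \sum_(m <- msupp law_poly) (law_poly@_m *: 'X_[m]) *: 'X^(mdeg m).
  rewrite compE raddf_sum; apply: eq_bigr => m _ /=.
  by rewrite muniZ c2 mul_polyC scalerA mul_mpolyC.
apply/dhomogP => m0 m0P; apply/eqP; apply: contraTT m0P => degm0.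
move/(congr1 (fun p => (muni p)`_(mdeg m0))): key.
rewrite m2 rmorphM rmorphXn /= mT m1 mulrC coefCM coefXn (negbTE degm0) mulr0.
rewrite coef_sum => /(congr1 (mcoeff m0)); rewrite raddf_sum raddf0 /=.
move=> h; rewrite mcoeff_msupp negbK -[X in _ == X]h.
rewrite [X in X@__](mpolyE law_poly) raddf_sum /=; apply/eqP.
apply: eq_bigr => m _; rewrite coefZ coefXn [mdeg m0 == _]eq_sym.
have [->|ne] := eqVneq m m0; first by rewrite eqxx mulr1.
case: (mdeg m == _); first by rewrite mulr1.
by rewrite mulr0 mcoeff0 mcoeffZ mcoeffX (negbTE ne) mulr0.
Qed.
End Generic.
End LawPolynomial.

Section QuadraticLaw.
Variable R : comNzRingType.

Lemma mdeg2P n (m : 'X_{1..n}) : mdeg m = 2 ->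
  exists i j, m = (U_(i) + U_(j))%MM.
Proof.
have step d (m1 : 'X_{1..n}) : mdeg m1 = d.+1 ->
    exists i m2, m1 = (U_(i) + m2)%MM /\ mdeg m2 = d.
  move=> m1d; have /existsP[i mi] : [exists i, m1 i != 0%N].
    apply: contraPT m1d => /existsPn h; rewrite mdegE big1 // => i _.
    by apply/eqP/negPn.
  exists i, (m1 - U_(i))%MM; have e : m1 = (U_(i) + (m1 - U_(i)))%MM.
    by rewrite addmC submK // lep1mP.
  by split=> //; move: m1d; rewrite {1}e mdegD mdeg1 add1n => -[].
move=> /step[i [m1 [-> /step[j [m2 [-> /eqP]]]]]].
by rewrite mdeg_eq0 => /eqP->; exists i, j; rewrite addm0.
Qed.

(** Both sides are linear in [p], so it suffices to treat [X_i X_j]. *)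
Lemma homog2_polarP n (p : {mpoly R[n]}) (t : R) (u v w : 'I_n -> R) :
  p \is 2.-homog ->
  p.@[fun i => t * u i + v i + w i] - p.@[fun i => t * u i + v i] - p.@[w] =
  t * (p.@[fun i => u i + w i] - p.@[u] - p.@[w])
    + (p.@[fun i => v i + w i] - p.@[v] - p.@[w]).
Proof.
move/dhomogP=> hp.
have evalE z : p.@[z] = \sum_(m <- msupp p) p@_m * ('X_[m]).@[z].
  by rewrite {1}[p]mpolyE [LHS]raddf_sum; apply: eq_bigr => m _; apply: mevalZ.
rewrite !evalE -!sumrB mulr_sumr -big_split /=.
apply: eq_big_seq => m /hp /mdeg2P[i [j ->]].
by rewrite !mpolyXD !mevalM !mevalXU; ring.
Qed.

Variables (M : lmodType R) (F : polyLaw M R^o).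
Hypothesis F2 : law_homogeneous 2 F.

(** Left linearity of the polar form, which is symmetric by construction; with
    [law_mapZ2] this makes the map underlying the law an ordinary quadratic
    form. *)
Lemma quad_polarP (t : R) (x y z : M) :
  polar F (t *: x + y) z = t * polar F x z + polar F y z.
Proof.
pose e (i : 'I_3) := nth 0 [:: x; y; z] i.
pose c (a b d : R) (i : 'I_3) := nth 0 [:: a; b; d] i.
have E a b d : law_map F (a *: x + b *: y + d *: z) = (law_poly F e).@[c a b d] :> R.
  by rewrite -law_polyE !big_ord_recr big_ord0 /= add0r.
have := homog2_polarP t (c 1 0 0) (c 0 1 0) (c 0 0 1) (law_poly_homog e F2).
have sim a b d g : g =1 c a b d ->
    (law_poly F e).@[g] = law_map F (a *: x + b *: y + d *: z).
  by move=> eg; rewrite E; apply: meval_eq.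
have ord3 (f g : 'I_3 -> R) : f 0 = g 0 -> f 1 = g 1 -> f 2%:R = g 2%:R -> f =1 g.
  move=> f0 f1 f2 [[|[|[|//]]] lti].
  - by move: f0; congr (f _ = g _); apply: val_inj.
  - by move: f1; congr (f _ = g _); apply: val_inj.
  - by move: f2; congr (f _ = g _); apply: val_inj.
rewrite (sim t 1 1); last by apply: ord3; rewrite /c /=; ring.
rewrite (sim t 1 0); last by apply: ord3; rewrite /c /=; ring.
rewrite (sim 0 0 1); last by [].
rewrite (sim 1 0 1); last by apply: ord3; rewrite /c /=; ring.
rewrite (sim 1 0 0); last by [].
rewrite (sim 0 1 1); last by apply: ord3; rewrite /c /=; ring.
rewrite (sim 0 1 0); last by [].
by rewrite !scale1r !scale0r !(add0r, addr0).
Qed.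

Lemma law_mapZ2 (t : R) (x : M) : law_map F (t *: x) = t ^+ 2 * law_map F x :> R.
Proof.
rewrite /law_map tensZl -[t *: 1]mulr1 -tensZ F2 -!tscalar_unit tscalarZ.
by congr (_ ^+ 2 * _); apply: mulr1.
Qed.
End QuadraticLaw.

(** * Identities and duality in a composition algebra *)

Section CompositionIdentities.
Variables (R : comNzRingType) (C : compAlg R).
Local Notation n := (@ca_n R C).
Local Notation b := (@ca_n2 R C).
Local Notation mul := (ca_mul C).
Local Notation one := (ca_one C).
Implicit Types (x y z w c : C) (t : R).

Lemma ca_nD x y : n (x + y) = n x + n y + b x y.
Proof. by rewrite /ca_n2 /polar -/(n _) -/(n x) -/(n y); ring. Qed.

Lemma ca_nZ t x : n (t *: x) = t ^+ 2 * n x.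
Proof. exact: (law_mapZ2 (@ca_norm_quadratic _ C)). Qed.

Lemma ca_n2C x y : b x y = b y x.
Proof. by rewrite /ca_n2 /polar [y + x]addrC; ring. Qed.

Lemma ca_n2Pl t x y z : b (t *: x + y) z = t * b x z + b y z.
Proof. exact: (quad_polarP (@ca_norm_quadratic _ C)). Qed.

Lemma ca_n2Dl x y z : b (x + y) z = b x z + b y z.
Proof. by have := ca_n2Pl 1 x y z; rewrite scale1r mul1r. Qed.

Lemma ca_n20l z : b 0 z = 0.
Proof. by apply: (@addrI _ (b 0 z)); rewrite -ca_n2Dl !addr0. Qed.

Lemma ca_n2Zl t x z : b (t *: x) z = t * b x z.
Proof. by have := ca_n2Pl t x 0 z; rewrite ca_n20l !addr0. Qed.

Lemma ca_n2Nl x z : b (- x) z = - b x z.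
Proof. by rewrite -scaleN1r ca_n2Zl mulN1r. Qed.

Lemma ca_n2Dr x y z : b z (x + y) = b z x + b z y.
Proof. by rewrite ca_n2C ca_n2Dl !(ca_n2C z). Qed.
Lemma ca_n20r z : b z 0 = 0. Proof. by rewrite ca_n2C ca_n20l. Qed.
Lemma ca_n2Zr t x z : b z (t *: x) = t * b z x.
Proof. by rewrite ca_n2C ca_n2Zl ca_n2C. Qed.
Lemma ca_n2Nr x z : b z (- x) = - b z x.
Proof. by rewrite ca_n2C ca_n2Nl ca_n2C. Qed.

Definition ca_n2E :=
  (ca_n2Dl, ca_n2Dr, ca_n2Zl, ca_n2Zr, ca_n2Nl, ca_n2Nr, ca_n20l, ca_n20r).

Lemma ca_n2xx x : b x x = 2%:R * n x.
Proof.
rewrite /ca_n2 /polar -[x + x]mulr2n -scaler_nat -/(n _) ca_nZ /ca_n; ring.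
Qed.

Lemma ca_n0 : n 0 = 0.
Proof. by rewrite -(scale0r 0) ca_nZ expr0n mul0r. Qed.

Lemma ca_nN x : n (- x) = n x.
Proof. by rewrite -scaleN1r ca_nZ sqrrN expr1n mul1r. Qed.

(** Regularity of the norm: identities in the possibly nonassociative [C] are
    reduced to identities in [R], where [ring] applies. *)
Lemma ca_eqP x y : (forall w, b x w = b y w) -> x = y.
Proof.
move=> exy.
have bl : linear (fun w => b x w : R^o) by move=> t u v; rewrite !ca_n2E.
pose phi : {linear C -> R^o} :=
  HB.pack (fun w => b x w : R^o) (GRing.isLinear.Build _ _ _ _ _ bl).
have [z [_ uz]] := ca_norm_regular phi.
by rewrite -(uz x) ?(uz y) // => w; apply: exy.
Qed.

Lemma ca_mulDl x y z : mul (x + y) z = mul x z + mul y z.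
Proof. exact: linearDl. Qed.
Lemma ca_mulDr x y z : mul z (x + y) = mul z x + mul z y.
Proof. exact: linearDr. Qed.
Lemma ca_mulZl t x z : mul (t *: x) z = t *: mul x z.
Proof. exact: linearZl_LR. Qed.
Lemma ca_mulZr t x z : mul z (t *: x) = t *: mul z x.
Proof. exact: linearZr_LR. Qed.
Lemma ca_mulNl x z : mul (- x) z = - mul x z.
Proof. exact: linearNl. Qed.
Lemma ca_mulNr x z : mul z (- x) = - mul z x.
Proof. exact: linearNr. Qed.
Lemma ca_mul0l z : mul 0 z = 0.
Proof. exact: linear0l. Qed.
Lemma ca_mul0r z : mul z 0 = 0.
Proof. exact: linear0r. Qed.

Definition ca_mulE :=
  (ca_mulDl, ca_mulDr, ca_mulZl, ca_mulZr, ca_mulNl, ca_mulNr, ca_mul0l, ca_mul0r).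

Lemma ca_nM x y : n (mul x y) = n x * n y.
Proof. exact: ca_normM. Qed.

Lemma ca_n2Ml x y z : b (mul x y) (mul x z) = n x * b y z.
Proof.
apply: (@addrI _ (n (mul x y) + n (mul x z))).
by rewrite -ca_nD -linearDr !ca_nM ca_nD; ring.
Qed.

Lemma ca_n2Mr x y z : b (mul y x) (mul z x) = b y z * n x.
Proof.
apply: (@addrI _ (n (mul y x) + n (mul z x))).
by rewrite -ca_nD -linearDl !ca_nM ca_nD; ring.
Qed.

(** The full polarization of [n(xy) = n(x) n(y)]; with one argument equal to
    [1] it gives the adjunctions [ca_adjl] and [ca_adjr]. *)
Lemma ca_n2M x y z w :
  b (mul x y) (mul z w) + b (mul x w) (mul z y) = b x z * b y w.
Proof.
have := ca_n2Ml (x + z) y w.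
rewrite !linearDl /= ca_nD !ca_n2E !ca_n2Ml (ca_n2C (mul z y)) => h.
by apply: (@addrI _ (n x * b y w + n z * b y w)); apply: etrans (etrans _ h) _; ring.
Qed.

(** The conjugation, locked: otherwise rewriting with additivity would see
    through [ca_conj] to the difference that defines it. *)
Definition ca_bar : C -> C := locked (@ca_conj R C).
Local Notation conj := ca_bar.

Lemma ca_barE x : conj x = ca_trace x *: one - x.
Proof. by rewrite /ca_bar -lock. Qed.

Lemma ca_barP t x y : conj (t *: x + y) = t *: conj x + conj y.
Proof.
by apply: ca_eqP => w; rewrite !ca_barE /ca_trace !ca_n2E; ring.
Qed.

Lemma ca_barD x y : conj (x + y) = conj x + conj y.
Proof. by have := ca_barP 1 x y; rewrite !scale1r. Qed.

Lemma ca_bar0 : conj 0 = 0.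
Proof. by rewrite !ca_barE /ca_trace ca_n20l scale0r subr0. Qed.

Lemma ca_barZ t x : conj (t *: x) = t *: conj x.
Proof. by have := ca_barP t x 0; rewrite ca_bar0 !addr0. Qed.

Lemma ca_barN x : conj (- x) = - conj x.
Proof. by rewrite -scaleN1r ca_barZ scaleN1r. Qed.

Lemma ca_n2_barl x y : b (conj x) y = b x (conj y).
Proof. by rewrite !ca_barE /ca_trace !ca_n2E (ca_n2C one y); ring. Qed.

Lemma ca_n1 : n one = 1. Proof. exact: ca_norm1. Qed.

Lemma ca_barK x : conj (conj x) = x.
Proof.
apply: ca_eqP => w.
by rewrite !ca_barE /ca_trace !ca_n2E ca_n2xx ca_n1; ring.
Qed.

Lemma ca_n_bar x : n (conj x) = n x.
Proof.
by rewrite !ca_barE ca_nD ca_nZ ca_nN ca_n1 !ca_n2E (ca_n2C one) /ca_trace; ring.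
Qed.

Lemma ca_adjl x y w : b (mul x y) w = b y (mul (conj x) w).
Proof.
have := ca_n2M x y one w; rewrite !ca_mul1l => h.
rewrite !ca_barE linearDl linearNl linearZl_LR /= ca_mul1l !ca_n2E.
by rewrite /ca_trace (ca_n2C y (mul x w)) -h; ring.
Qed.

Lemma ca_adjr x y w : b (mul x y) w = b x (mul w (conj y)).
Proof.
have := ca_n2M x y w one; rewrite !ca_mul1r => h.
rewrite !ca_barE linearDr linearNr linearZr_LR /= ca_mul1r !ca_n2E.
by rewrite /ca_trace [_ * b x w]mulrC -h; ring.
Qed.

(** Both sides pair with [w] to the cyclic trace of [x], [y] and [w]. *)
Lemma ca_barM x y : conj (mul x y) = mul (conj y) (conj x).
Proof.
apply: ca_eqP => w.
rewrite ca_n2_barl [RHS]ca_adjl ca_barK [RHS]ca_n2C [RHS]ca_adjr.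
by rewrite [RHS]ca_n2C [RHS]ca_adjl ca_barK ca_n2C.
Qed.

Lemma ca_mulKl x y : mul (conj x) (mul x y) = n x *: y.
Proof.
by apply: ca_eqP => w; rewrite ca_adjl ca_barK ca_n2Ml !ca_n2E.
Qed.

Lemma ca_mulKr x y : mul (mul y x) (conj x) = n x *: y.
Proof.
by apply: ca_eqP => w; rewrite ca_adjr ca_barK ca_n2Mr !ca_n2E mulrC.
Qed.

Lemma ca_mulKl2 x z y :
  mul (conj x) (mul z y) + mul (conj z) (mul x y) = b x z *: y.
Proof.
have := ca_mulKl (x + z) y.
rewrite ca_barD !ca_mulE !ca_mulKl ca_nD !scalerDl => h.
apply: (@addrI _ (n x *: y + n z *: y)); rewrite -h -!addrA; congr (_ + _).
by rewrite addrCA; congr (_ + _); rewrite addrC.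
Qed.

Lemma ca_mulKr2 x z y :
  mul (mul y z) (conj x) + mul (mul y x) (conj z) = b x z *: y.
Proof.
have := ca_mulKr (x + z) y.
rewrite ca_barD !ca_mulE !ca_mulKr ca_nD !scalerDl => h.
apply: (@addrI _ (n x *: y + n z *: y)); rewrite -h -!addrA; congr (_ + _).
by rewrite addrC -addrA.
Qed.

(** A splitting of [R^m -> C] has linear coordinates, each of which is
    [n(d, -)] for some [d]. *)
Lemma ca_dual_basis : exists m (e d : 'I_m -> C),
  forall c, c = \sum_i b (d i) c *: e i.
Proof.
have [m [e e_gen]] := ca_fin_gen C.
pose g (v : {ffun 'I_m -> R^o}) : C := \sum_i (v i : R) *: e i.
have gl : linear g.
  move=> t u v; rewrite /g scaler_sumr -big_split; apply: eq_bigr => i _ /=.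
  by rewrite !ffunE scalerDl scalerA.
pose G : {linear {ffun 'I_m -> R^o} -> C} :=
  HB.pack g (GRing.isLinear.Build _ _ _ _ _ gl).
have gsurj y : exists v, G v = y.
  have [a ->] := e_gen y; exists [ffun i => a i].
  by apply: eq_bigr => i _; rewrite ffunE.
have [k kP] := ca_projective (idfun : {linear C -> C}) gsurj.
have dP i : exists d, forall c, k c i = b d c.
  have kl : linear (fun c => k c i : R^o).
    by move=> t u v; rewrite linearP !ffunE.
  pose phi : {linear C -> R^o} :=
    HB.pack (fun c => k c i : R^o) (GRing.isLinear.Build _ _ _ _ _ kl).
  by have [d [dE _]] := ca_norm_regular phi; exists d.
have [d dE] := fin_all_exists dP.
exists m, e, d => c; rewrite -[LHS]/(idfun c) -kP.
by apply: eq_bigr => i _; rewrite dE.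
Qed.

(** An element orthogonal to [C] modulo [P] lies in [P C] by
    [ca_dual_basis], so its norm vanishes modulo [P]. *)
Lemma ca_n_ideal (P : prime_idealr R) c :
  (forall a, b c a \in P) -> n c \in P.
Proof.
have [m [e [d cE]]] := ca_dual_basis; move=> cP; rewrite (cE c).
have PM u v : v \in P -> u * v \in P by move=> vP; apply: idealMr.
suff [] : n (\sum_i b (d i) c *: e i) \in P /\
    forall a, b (\sum_i b (d i) c *: e i) a \in P by [].
elim/big_ind: _ => [|u v [nu bu] [nv bv]|i _].
- by split=> [|a]; [rewrite ca_n0 | rewrite ca_n20l]; rewrite rpred0.
- split=> [|a]; first by rewrite ca_nD; apply: rpredD; first exact: rpredD.
  by rewrite ca_n2Dl; apply: rpredD.
have bP : b (d i) c \in P by rewrite ca_n2C.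
split=> [|a]; first by rewrite ca_nZ expr2 mulrC mulrA PM.
by rewrite ca_n2Zl mulrC PM.
Qed.

(** Otherwise [n(1) = 1] would lie in [P]. *)
Lemma ca_n2_notin (P : prime_idealr R) : exists x y, b x y \notin P.
Proof.
apply: contrapT => h; have := idealr1 P; rewrite -ca_n1 ca_n_ideal // => a.
by apply/negP => /negP baP; apply: h; exists one, a.
Qed.
End CompositionIdentities.

(** * Transvections of hermitian matrices *)

(** The cyclic indices: formulas for all [k] at once replace a threefold case
    distinction. *)
Section Indices.
Implicit Types k l : 'I_3.

Lemma I3_cases k l : [\/ l = k, l = k + 1 | l = k + 2].
Proof.
suff : [|| l == k, l == k + 1 | l == k + 2].
  by case/or3P => /eqP->; [constructor 1|constructor 2|constructor 3].
by case: k l => [[|[|[|//]]] ?] [[|[|[|//]]] ?].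
Qed.

Lemma I3_ind (Q : 'I_3 -> Prop) k :
  Q k -> Q (k + 1) -> Q (k + 2) -> forall l, Q l.
Proof. by move=> q0 q1 q2 l; case: (I3_cases k l) => ->. Qed.

Lemma I3_11 k : k + 1 + 1 = k + 2.
Proof. by rewrite -addrA. Qed.
Lemma I3_12 k : k + 1 + 2 = k.
Proof. by apply/eqP; case: k => [[|[|[|//]]] ?]. Qed.
Lemma I3_21 k : k + 2 + 1 = k.
Proof. by apply/eqP; case: k => [[|[|[|//]]] ?]. Qed.
Lemma I3_22 k : k + 2 + 2 = k + 1.
Proof. by apply/eqP; case: k => [[|[|[|//]]] ?]. Qed.
Lemma I3_n1 k : (k + 1 == k) = false.
Proof. by case: k => [[|[|[|//]]] ?]. Qed.
Lemma I3_n2 k : (k + 2 == k) = false.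
Proof. by case: k => [[|[|[|//]]] ?]. Qed.
Lemma I3_n12 k : (k + 1 == k + 2) = false.
Proof. by case: k => [[|[|[|//]]] ?]. Qed.
Lemma I3_n01 k : (k == k + 1) = false.
Proof. by rewrite eq_sym I3_n1. Qed.
Lemma I3_n02 k : (k == k + 2) = false.
Proof. by rewrite eq_sym I3_n2. Qed.
Lemma I3_n21 k : (k + 2 == k + 1) = false.
Proof. by rewrite eq_sym I3_n12. Qed.

Definition I3E := (I3_11, I3_12, I3_21, I3_22,
  (I3_n1, I3_n2, I3_n12), (I3_n01, I3_n02, I3_n21), eqxx).

Lemma I3_sum (V : nmodType) (F : 'I_3 -> V) k :
  \sum_i F i = F k + F (k + 1) + F (k + 2).
Proof.
rewrite (bigD1 k) //= (bigD1 (k + 1)) ?I3E //= (bigD1 (k + 2)) ?I3E //= big1.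
  by rewrite addr0 addrA.
by move=> l; case: (I3_cases k l) => ->; rewrite !I3E.
Qed.
End Indices.

Section HermitianAlgebra.
Variables (R : comNzRingType) (C : compAlg R).
Local Notation n := (@ca_n R C).
Local Notation b := (@ca_n2 R C).
Local Notation mul := (ca_mul C).
Local Notation conj := (@ca_bar R C).
Local Notation H := (her_mod C).

Lemma her_eqP (k : 'I_3) (x y : H) :
    (forall l, l \in [:: k; k + 1; k + 2] -> her_diag x l = her_diag y l) ->
    (forall l, l \in [:: k; k + 1; k + 2] -> her_off x l = her_off y l) ->
  x = y.
Proof.
case: x y => [x1 x2] [y1 y2] ed eo; congr pair; apply/ffunP => l.
  by apply: ed; case: (I3_cases k l) => ->; rewrite !inE !I3E ?orbT.
by apply: eo; case: (I3_cases k l) => ->; rewrite !inE !I3E ?orbT.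
Qed.

Lemma her_linE (t : R) (x y : H) :
  (her_diag (t *: x + y) =1 fun l => t * her_diag x l + her_diag y l) *
  (her_off (t *: x + y) =1 fun l => t *: her_off x l + her_off y l).
Proof. by split=> l; rewrite /her_diag /her_off /= !ffunE. Qed.

Section OneDiagonal.
Variable G : 'M[R]_3.
Local Notation g i := (G i i).
Local Notation sharp := (@her_sharp R C G).
Local Notation T := (@her_T R C G).
Local Notation cross := (@her_cross R C G).

Lemma her_sharp_diag (x : H) l : her_diag (sharp x) l =
  her_diag x (l + 1) * her_diag x (l + 2) - g (l + 1) * g (l + 2) * n (her_off x l).
Proof. by rewrite /her_diag ffunE. Qed.

Lemma her_sharp_off (x : H) l : her_off (sharp x) l =
  - (her_diag x l *: her_off x l)
  + g l *: conj (mul (her_off x (l + 1)) (her_off x (l + 2))).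
Proof. by rewrite /her_off ffunE /ca_bar -lock. Qed.

(** With [i = k + 1] and [j = k + 2], this is [x |-> t x t'] for
    [t = 1 + g_j a e_ij] and [t' = 1 + g_i a^ e_ji], the hermitian
    transvection that adds a multiple of row [j] to row [i].  The factor [g_j]
    in [t] avoids inverting the entries of [Gamma]. *)
Definition transv_up (k : 'I_3) (a : C) (x : H) : H :=
  ([ffun l => if l == k + 1 then her_diag x l +
       g (k + 1) * g (k + 2) * (b a (her_off x k) + n a * her_diag x (k + 2))
     else her_diag x l],
   [ffun l => if l == k then her_off x k + her_diag x (k + 2) *: a
     else if l == k + 2 then
       her_off x l + g l *: conj (mul a (her_off x (k + 1)))
     else her_off x l]).

(** The opposite transvection, with [t = 1 + g_i a^ e_ji]. *)
Definition transv_low (k : 'I_3) (a : C) (x : H) : H :=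
  ([ffun l => if l == k + 2 then her_diag x l +
       g (k + 1) * g (k + 2) * (b a (her_off x k) + n a * her_diag x (k + 1))
     else her_diag x l],
   [ffun l => if l == k then her_off x k + her_diag x (k + 1) *: a
     else if l == k + 1 then
       her_off x l + g l *: conj (mul (her_off x (k + 2)) a)
     else her_off x l]).

Lemma transv_upE k a x :
  (her_diag (transv_up k a x) k = her_diag x k) *
  (her_diag (transv_up k a x) (k + 1) = her_diag x (k + 1) +
     g (k + 1) * g (k + 2) * (b a (her_off x k) + n a * her_diag x (k + 2))) *
  (her_diag (transv_up k a x) (k + 2) = her_diag x (k + 2)) *
  (her_off (transv_up k a x) k = her_off x k + her_diag x (k + 2) *: a) *
  (her_off (transv_up k a x) (k + 1) = her_off x (k + 1)) *
  (her_off (transv_up k a x) (k + 2) =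
     her_off x (k + 2) + g (k + 2) *: conj (mul a (her_off x (k + 1)))).
Proof. by rewrite /transv_up /her_diag /her_off /= !ffunE !I3E. Qed.

Lemma transv_lowE k a x :
  (her_diag (transv_low k a x) k = her_diag x k) *
  (her_diag (transv_low k a x) (k + 1) = her_diag x (k + 1)) *
  (her_diag (transv_low k a x) (k + 2) = her_diag x (k + 2) +
     g (k + 1) * g (k + 2) * (b a (her_off x k) + n a * her_diag x (k + 1))) *
  (her_off (transv_low k a x) k = her_off x k + her_diag x (k + 1) *: a) *
  (her_off (transv_low k a x) (k + 1) =
     her_off x (k + 1) + g (k + 1) *: conj (mul (her_off x (k + 2)) a)) *
  (her_off (transv_low k a x) (k + 2) = her_off x (k + 2)).
Proof. by rewrite /transv_low /her_diag /her_off /= !ffunE !I3E. Qed.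

Definition ca_nE := (@ca_nD R C, @ca_nZ R C, @ca_nN R C, @ca_nM R C,
  @ca_n_bar R C, @ca_n0 R C).
Definition ca_bar_simpE :=
  (@ca_barD R C, @ca_barZ R C, @ca_barN R C, @ca_barM R C, @ca_barK R C,
   @ca_bar0 R C).

Lemma in3P (k l : 'I_3) : l \in [:: k; k + 1; k + 2] ->
  [\/ l = k, l = k + 1 | l = k + 2].
Proof. by move=> _; apply: I3_cases. Qed.

Lemma ca_n2_cycle x y z :
  b x (mul (conj y) (conj z)) = b y (mul (conj z) (conj x)).
Proof. by rewrite -ca_adjr -ca_n2_barl ca_barM ca_n2C. Qed.

(** The adjoint of a matrix transforms by the inverse adjoint operation, here
    the opposite transvection with parameter [- a]. *)
Lemma transv_up_sharp k a x : sharp (transv_up k a x) = transv_low k (- a) (sharp x).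
Proof.
apply: (her_eqP (k := k)) => l /in3P[] ->; rewrite transv_lowE;
  rewrite !(her_sharp_diag, her_sharp_off) ?I3E !transv_upE;
  move: (her_diag x) (her_off x) => al c.
- by rewrite !ca_nE !ca_n2E (ca_n2C a); ring.
- by rewrite ?I3E.
- by rewrite !ca_nE !ca_n2E !ca_bar_simpE (ca_n2_cycle a); ring.
- apply: ca_eqP => w; rewrite !(ca_bar_simpE, ca_mulE) !ca_n2E.
  by rewrite ca_mulKr !ca_n2E; ring.
- apply: ca_eqP => w; rewrite !(ca_bar_simpE, ca_mulE) !ca_n2E.
  have := congr1 (b^~ w) (ca_mulKl2 a (c k) (c (k + 1))).
  by rewrite /= !ca_mulKl !ca_n2E => /(canRL (addrK _)) ->; ring.
- by apply: ca_eqP => w; rewrite !(ca_bar_simpE, ca_mulE) !ca_n2E; ring.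
Qed.

Lemma transv_low_sharp k a x : sharp (transv_low k a x) = transv_up k (- a) (sharp x).
Proof.
apply: (her_eqP (k := k)) => l /in3P[] ->; rewrite transv_upE;
  rewrite !(her_sharp_diag, her_sharp_off) ?I3E !transv_lowE;
  move: (her_diag x) (her_off x) => al c.
- by rewrite !ca_nE !ca_n2E (ca_n2C a); ring.
- rewrite !ca_nE !ca_n2E !ca_bar_simpE (ca_n2_cycle a) (ca_n2_cycle (c (k + 2))).
  by ring.
- by rewrite ?I3E.
- apply: ca_eqP => w; rewrite !(ca_bar_simpE, ca_mulE) !ca_n2E.
  by rewrite ca_mulKl !ca_n2E; ring.
- by apply: ca_eqP => w; rewrite !(ca_bar_simpE, ca_mulE) !ca_n2E; ring.
- apply: ca_eqP => w; rewrite !(ca_bar_simpE, ca_mulE) !ca_n2E.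
  have := congr1 (b^~ w) (ca_mulKr2 a (c k) (c (k + 2))).
  by rewrite /= !ca_mulKr !ca_n2E => /(canRL (addrK _)) ->; ring.
Qed.

Lemma her_TE k x y : T x y =
  her_diag x k * her_diag y k
  + g (k + 1) * g (k + 2) * b (her_off x k) (her_off y k)
  + (her_diag x (k + 1) * her_diag y (k + 1)
     + g (k + 2) * g k * b (her_off x (k + 1)) (her_off y (k + 1)))
  + (her_diag x (k + 2) * her_diag y (k + 2)
     + g k * g (k + 1) * b (her_off x (k + 2)) (her_off y (k + 2))).
Proof. by rewrite /her_T (I3_sum _ k) !I3E. Qed.

(** The opposite transvection is the inverse of the adjoint for the trace
    form. *)
Lemma transv_T k a x y : T (transv_up k a x) (transv_low k (- a) y) = T x y.
Proof.
rewrite !(her_TE k) !transv_upE !transv_lowE.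
move: (her_diag x) (her_off x) (her_diag y) (her_off y) => al c be d.
rewrite !(ca_bar_simpE, ca_mulE) !ca_n2E ca_nN ca_n2xx.
rewrite (ca_n2C (c k) a) (ca_n2C (mul _ _) (d (k + 2))) (ca_n2_cycle (d (k + 2))).
by ring.
Qed.

Lemma her_TC x y : T x y = T y x.
Proof.
by rewrite /her_T; apply: eq_bigr => i _; rewrite ca_n2C; ring.
Qed.

Lemma transv_upK k a : cancel (transv_up k a) (transv_up k (- a)).
Proof.
move=> x; apply: (her_eqP (k := k)) => l /in3P[] ->; rewrite !transv_upE //.
- by rewrite !ca_n2E ca_nN ca_n2xx; ring.
- by rewrite scalerN addrK.
- by rewrite !(ca_bar_simpE, ca_mulE) scalerN addrK.
Qed.

Lemma transv_lowK k a : cancel (transv_low k a) (transv_low k (- a)).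
Proof.
move=> x; apply: (her_eqP (k := k)) => l /in3P[] ->; rewrite !transv_lowE //.
- by rewrite !ca_n2E ca_nN ca_n2xx; ring.
- by rewrite scalerN addrK.
- by rewrite !(ca_bar_simpE, ca_mulE) scalerN addrK.
Qed.

Lemma transv_up_linear k a : linear (transv_up k a).
Proof.
move=> t x y; apply: (her_eqP (k := k)) => l /in3P[] ->;
  rewrite !(her_linE, transv_upE) // ?ca_n2E; first ring.
  by apply: ca_eqP => w; rewrite !ca_n2E; ring.
by apply: ca_eqP => w; rewrite !(ca_bar_simpE, ca_mulE) !ca_n2E; ring.
Qed.

Lemma transv_low_linear k a : linear (transv_low k a).
Proof.
move=> t x y; apply: (her_eqP (k := k)) => l /in3P[] ->;
  rewrite !(her_linE, transv_lowE) // ?ca_n2E; first ring.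
  by apply: ca_eqP => w; rewrite !ca_n2E; ring.
by apply: ca_eqP => w; rewrite !(ca_bar_simpE, ca_mulE) !ca_n2E; ring.
Qed.

Lemma her_crossE x y l :
  (her_diag (cross x y) l =
     her_diag x (l + 1) * her_diag y (l + 2) + her_diag x (l + 2) * her_diag y (l + 1)
     - g (l + 1) * g (l + 2) * b (her_off x l) (her_off y l)) *
  (her_off (cross x y) l =
     - (her_diag x l *: her_off y l + her_diag y l *: her_off x l)
     + g l *: conj (mul (her_off x (l + 1)) (her_off y (l + 2))
                    + mul (her_off y (l + 1)) (her_off x (l + 2)))).
Proof.
have hD (u v : H) : (her_diag (u - v) l = her_diag u l - her_diag v l) *
    (her_off (u - v) l = her_off u l - her_off v l).
  by split; rewrite /her_diag /her_off /= !ffunE.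
have hA (u v : H) i : (her_diag (u + v) i = her_diag u i + her_diag v i) *
    (her_off (u + v) i = her_off u i + her_off v i).
  by split; rewrite /her_diag /her_off /= !ffunE.
split; rewrite /her_cross !hD !(her_sharp_diag, her_sharp_off) !hA.
  by rewrite ca_nD; ring.
by apply: ca_eqP => w; rewrite !(ca_bar_simpE, ca_mulE) !ca_n2E; ring.
Qed.

Lemma her_crossZl t x y : cross (t *: x) y = t *: cross x y.
Proof.
have hZ (u : H) i : (her_diag (t *: u) i = t * her_diag u i) *
    (her_off (t *: u) i = t *: her_off u i).
  by split; rewrite /her_diag /her_off /= !ffunE.
apply: (her_eqP (k := 0)) => l _; rewrite hZ !her_crossE !hZ.
  by rewrite ca_n2E; ring.
by apply: ca_eqP => w; rewrite !(ca_bar_simpE, ca_mulE) !ca_n2E; ring.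
Qed.

End OneDiagonal.
End HermitianAlgebra.

(** * Isotopes along norm similarities *)

Section IsomorphismTheory.
Variable R : comNzRingType.
Implicit Types J : uAlg R.

Lemma isomorphic_intro J J' (f : J -> J') :
    linear f -> bijective f -> f (ua_one J) = ua_one J' ->
    (forall x y, f (ua_U x y) = ua_U (f x) (f y)) ->
  isomorphic J J'.
Proof.
move=> fl fb f1 fU.
by exists (HB.pack f (GRing.isLinear.Build _ _ _ _ f fl) : {linear J -> J'}).
Qed.

Lemma isomorphic_trans J1 J2 J3 :
  isomorphic J1 J2 -> isomorphic J2 J3 -> isomorphic J1 J3.
Proof.
move=> [f [fb f1 fU]] [h [hb h1 hU]].
apply: (@isomorphic_intro _ _ (h \o f)) => [t x y||| x y] /=.
- by rewrite !linearP.
- exact: bij_comp.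
- by rewrite f1.
- by rewrite fU hU.
Qed.

Lemma isomorphic_sym J J' : isomorphic J J' -> isomorphic J' J.
Proof.
move=> [f [[h fK hK] f1 fU]].
apply: (@isomorphic_intro _ _ h) => [t x y||| x y].
- by apply: (can_inj fK); rewrite linearP !hK.
- by exists f.
- by rewrite -f1 fK.
- by apply: (can_inj fK); rewrite fU !hK.
Qed.
End IsomorphismTheory.

Section HermitianIsotopes.
Variables (R : comNzRingType) (C : compAlg R).
Local Notation H := (her_mod C).
Local Notation U G := (@ua_U R (Her3 C G)).

(** The operator [U] depends on the trace form and the adjoint only.  The
    factor [k] covers the diagonal case, where the two maps [phi] and [rho]
    multiply the norm by [k^-1] and [k]. *)
Lemma her_U_similarity (G1 G2 : 'M[R]_3) (phi rho : H -> H) (k k' : R) :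
    linear phi -> linear rho -> k' * k = 1 ->
    (forall x y, her_T G2 (phi x) (rho y) = her_T G1 x y) ->
    (forall x, k *: her_sharp G2 (phi x) = rho (her_sharp G1 x)) ->
    (forall x, her_sharp G2 (rho x) = k *: phi (her_sharp G1 x)) ->
  forall x y, U G2 (phi x) (rho y) = phi (U G1 x y).
Proof.
move=> phiL rhoL k'k hT hphi hrho x y.
have linD (f : H -> H) (fL : linear f) (u v : H) : f (u + v) = f u + f v :> H.
  by have := fL 1 u v; rewrite !scale1r.
have lin0 (f : H -> H) (fL : linear f) : f 0 = 0 :> H.
  by apply: (@addrI _ (f 0)); rewrite -(linD _ fL) !addr0.
have linZ (f : H -> H) (fL : linear f) t (u : H) : f (t *: u) = t *: f u :> H.
  by have := fL t u 0; rewrite (lin0 _ fL) !addr0.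
have linB (f : H -> H) (fL : linear f) (u v : H) : f (u - v) = f u - f v :> H.
  by rewrite (linD _ fL) -scaleN1r (linZ _ fL) scaleN1r.
have crossE u v : her_cross G2 (rho u) (rho v) = k *: phi (her_cross G1 u v).
  by rewrite /her_cross -(linD _ rhoL) !hrho -!scalerBr !(linB _ phiL).
have sharpE : her_sharp G2 (phi x) = k' *: rho (her_sharp G1 x).
  by rewrite -hphi scalerA k'k scale1r.
rewrite /= hT sharpE her_crossZl crossE scalerA k'k scale1r [RHS](linB _ phiL).
by congr (_ - _); apply/esym/linZ.
Qed.

Variable G : 'M[R]_3.

Lemma transv_up_U k a x y :
  U G (transv_up G k a x) (transv_low G k (- a) y) = transv_up G k a (U G x y).
Proof.
apply: (@her_U_similarity _ _ _ _ 1 1); rewrite ?mulr1 // => *.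
- exact: transv_up_linear.
- exact: transv_low_linear.
- exact: transv_T.
- by rewrite scale1r transv_up_sharp.
- by rewrite scale1r transv_low_sharp opprK.
Qed.

Lemma transv_low_U k a x y :
  U G (transv_low G k a x) (transv_up G k (- a) y) = transv_low G k a (U G x y).
Proof.
apply: (@her_U_similarity _ _ _ _ 1 1); rewrite ?mulr1 // => *.
- exact: transv_low_linear.
- exact: transv_up_linear.
- by rewrite her_TC -{2}[a]opprK transv_T her_TC.
- by rewrite scale1r transv_low_sharp.
- by rewrite scale1r transv_up_sharp opprK.
Qed.

Definition her_isotope (v e : H) : uAlg R :=
  @UAlg R H (fun x y => U G x (U G v y)) e.

(** The unit [e] of the isotope is determined by [U_v e = v] when [U_v] is
    bijective; surjectivity is the form of invertibility of [v] that survives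
    reduction modulo a prime. *)
Definition isotope_hermitian (v : H) : Prop :=
  forall e : H, U G v e = v -> (forall y, exists z, U G v z = y) ->
  exists G' : 'M[R]_3, [/\ is_diag_mx G', forall i, exists t, t * G' i i = 1
    & isomorphic (her_isotope v e) (Her3 C G')].

(** For a pair with [U_(phi x) psi = phi U_x] and conversely, [phi] is itself
    an isomorphism from the isotope at [v] to the isotope at [psi v]. *)
Lemma isotope_hermitian_transfer (phi psi phi' psi' : H -> H) (v : H) :
    linear phi -> cancel phi phi' -> cancel phi' phi -> cancel psi' psi ->
    (forall x y, U G (phi x) (psi y) = phi (U G x y)) ->
    (forall x y, U G (psi x) (phi y) = psi (U G x y)) ->
  isotope_hermitian (psi v) -> isotope_hermitian v.
Proof.
move=> phiL phiK phiK' psiK phiU psiU dv e ve vsurj.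
have [||G' [Gd Gu iso]] := dv (phi e).
- by rewrite psiU ve.
- move=> y; have [z ez] := vsurj (psi' y); exists (phi z).
  by rewrite psiU ez psiK.
exists G'; split; [exact: Gd | exact: Gu | apply: isomorphic_trans iso].
apply: (@isomorphic_intro _ (her_isotope v e) (her_isotope (psi v) (phi e)) phi).
- exact: phiL.
- by exists phi'.
- by [].
move=> x y.
rewrite -[LHS]/(phi (U G x (U G v y))).
by rewrite -[RHS]/(U G (phi x) (U G (psi v) (phi y))) psiU phiU.
Qed.

Lemma isotope_hermitian_transv_up k a v :
  isotope_hermitian (transv_up G k a v) -> isotope_hermitian v.
Proof.
have PK' : cancel (transv_up G k (- a)) (transv_up G k a).
  by move=> x; rewrite -{1}[a]opprK transv_upK.
have MK' : cancel (transv_low G k (- a)) (transv_low G k a).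
  by move=> x; rewrite -{1}[a]opprK transv_lowK.
apply: (@isotope_hermitian_transfer (transv_low G k (- a)) _ (transv_low G k a)
  (transv_up G k (- a))) => //.
- exact: transv_low_linear.
- exact: transv_lowK.
- by move=> x y; rewrite -{2}[a]opprK transv_low_U.
- by move=> x y; rewrite transv_up_U.
Qed.

Lemma isotope_hermitian_transv_low k a v :
  isotope_hermitian (transv_low G k a v) -> isotope_hermitian v.
Proof.
have PK' : cancel (transv_up G k (- a)) (transv_up G k a).
  by move=> x; rewrite -{1}[a]opprK transv_upK.
have MK' : cancel (transv_low G k (- a)) (transv_low G k a).
  by move=> x; rewrite -{1}[a]opprK transv_lowK.
apply: (@isotope_hermitian_transfer (transv_up G k (- a)) _ (transv_up G k a)
  (transv_low G k (- a))) => //.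
- exact: transv_up_linear.
- exact: transv_upK.
- by move=> x y; rewrite -{2}[a]opprK transv_up_U.
- by move=> x y; rewrite transv_low_U.
Qed.

End HermitianIsotopes.

(** * Diagonalization over an LG ring *)

Section LGPolynomialFunctions.
Variable R : comUnitRingType.

Definition polyfun n (f : ('I_n -> R) -> R) : Prop :=
  exists p : {mpoly R[n]}, forall v, f v = p.@[v].

Lemma polyfun_const n (c : R) : polyfun (fun _ : 'I_n -> R => c).
Proof. by exists c%:MP => v; rewrite mevalC. Qed.

Lemma polyfun_add n (f h : ('I_n -> R) -> R) :
  polyfun f -> polyfun h -> polyfun (fun v => f v + h v).
Proof. by move=> [p pE] [q qE]; exists (p + q) => v; rewrite mevalD pE qE. Qed.

Lemma polyfun_mul n (f h : ('I_n -> R) -> R) :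
  polyfun f -> polyfun h -> polyfun (fun v => f v * h v).
Proof. by move=> [p pE] [q qE]; exists (p * q) => v; rewrite mevalM pE qE. Qed.

Lemma polyfun_lin n (c : 'I_n -> R) : polyfun (fun v => \sum_i v i * c i).
Proof.
exists (\sum_i 'X_i * (c i)%:MP) => v; rewrite raddf_sum.
by apply: eq_bigr => i _; rewrite /= mevalM mevalXU mevalC.
Qed.

(** A value outside [P] at a point of [R^n] becomes a unit in the localization
    at [P]. *)
Lemma LG_polyfun n (f : ('I_n -> R) -> R) : LG R -> polyfun f ->
    (forall P : prime_idealr R, exists v, f v \notin P) ->
  exists v, f v \is a GRing.unit.
Proof.
move=> hR [p pE] hP; suff [v vu] : represents_unit p by exists v; rewrite pE.
apply: hR => P _; have [v vP] := hP P; exists (fun i => to_loc P (v i)).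
have -> : (map_mpoly (to_loc P) p).@[fun i => to_loc P (v i)] = to_loc P p.@[v].
  rewrite [in RHS]mevalE (raddf_sum (to_loc P)) {1}[p]mpolyE.
  rewrite (raddf_sum (map_mpoly (to_loc P))) (raddf_sum (meval _)).
  apply: eq_bigr => m _; rewrite /= map_mpolyZ map_mpolyX mevalZ mevalX.
  rewrite rmorphM rmorph_prod; congr (_ * _).
  by apply: eq_bigr => i _; rewrite rmorphXn.
rewrite -pE; apply: (@loc_unitP _ _ _ (loc_frac 1 (exist _ (f v) vP))).
rewrite -[LHS]/(locM _ _) locME; apply: eq_loc_frac => /=; ring.
Qed.

End LGPolynomialFunctions.

Section Diagonalization.
Variables (R : comUnitRingType) (C : compAlg R) (G : 'M[R]_3).
Local Notation n := (@ca_n R C).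
Local Notation b := (@ca_n2 R C).
Local Notation mul := (ca_mul C).
Local Notation conj := (@ca_bar R C).
Local Notation H := (her_mod C).
Local Notation g i := (G i i).
Local Notation U := (@ua_U R (Her3 C G)).

Lemma polyfun_norm m (e : 'I_m -> C) :
  polyfun (fun v => n (\sum_i v i *: e i)).
Proof. by exists (law_poly (ca_norm C) e) => v; apply: law_polyE. Qed.

Lemma polyfun_polar m (e e' : 'I_m -> C) :
  polyfun (fun v => b (\sum_i v i *: e i) (\sum_i v i *: e' i)).
Proof.
have [p pE] := polyfun_norm (fun i => e i + e' i).
have [q qE] := polyfun_norm e; have [r rE] := polyfun_norm e'.
exists (p - q - r) => v; rewrite !mevalB -pE -qE -rE.
have -> : \sum_i v i *: (e i + e' i) = \sum_i v i *: e i + \sum_i v i *: e' i.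
  by rewrite -big_split; apply: eq_bigr => i _; rewrite scalerDr.
by rewrite ca_nD; ring.
Qed.

Lemma polyfun_polarl m (e : 'I_m -> C) c :
  polyfun (fun v => b (\sum_i v i *: e i) c).
Proof.
have [p pE] := polyfun_lin (fun i => b (e i) c); exists p => v; rewrite -pE.
rewrite (big_morph (b^~ c) (fun x y => ca_n2Dl x y c) (ca_n20l c)).
by apply: eq_bigr => i _; rewrite ca_n2Zl.
Qed.

Lemma her_U_diag x y l : her_diag (U x y) l =
  her_T G x y * her_diag x l - her_diag (her_cross G (her_sharp G x) y) l.
Proof. by rewrite /her_diag /= !ffunE. Qed.

Lemma her_U_off x y l : her_off (U x y) l =
  her_T G x y *: her_off x l - her_off (her_cross G (her_sharp G x) y) l.
Proof. by rewrite /her_off /= !ffunE. Qed.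

(** If row [l] of [v] vanishes modulo [P], so does row [l] of every [U_v y],
    while the identity matrix has a [1] there. *)
Lemma row_not_in_prime (P : prime_idealr R) (v : H) l :
    (forall y, exists z, U v z = y) ->
    her_diag v l \in P -> (forall a, b (her_off v (l + 1)) a \in P) ->
    (forall a, b (her_off v (l + 2)) a \in P) -> False.
Proof.
move=> vsurj aP c1P c2P; have [z ez] := vsurj (her_one C).
suff : (1 : R) \in P by rewrite idealr1.
have -> : 1 = her_diag (her_one C) l by rewrite /her_diag ffunE.
rewrite -ez her_U_diag her_crossE !her_sharp_diag her_sharp_off !I3E.
rewrite !ca_n2E ca_n2_barl ca_adjr; set X := b _ (mul _ _).
have XP : X \in P by apply: c1P.
apply: rpredB; first exact: idealMr.
apply: rpredB; last first.
  apply: idealMr; apply: rpredD; last exact: idealMr.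
  by rewrite rpredN mulrC; apply: idealMr.
apply: rpredD; rewrite mulrC; apply: idealMr; apply: rpredB; try exact: idealMr.
- by apply: idealMr; apply: ca_n_ideal.
- by rewrite mulrC; apply: idealMr.
- by apply: idealMr; apply: ca_n_ideal.
Qed.

Lemma unit_notin (P : prime_idealr R) (t : R) : t \is a GRing.unit -> t \notin P.
Proof.
move=> tu; apply/negP => tP; have := idealr1 P.
by rewrite -(mulVr tu) idealMr.
Qed.

(** The value at [0] gives [al], polarization isolates [be] times the
    polar form, which is nonzero modulo [P], and the linear part remains. *)
Lemma quad_coef_ideal (P : prime_idealr R) (al be t : R) (c : C) :
    t \is a GRing.unit -> (forall a, al + t * (b a c + n a * be) \in P) ->
  [/\ al \in P, be \in P & forall a, b c a \in P].
Proof.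
move=> tu h; have alP : al \in P.
  by have := h 0; rewrite ca_n20l ca_n0 mul0r addr0 mulr0 addr0.
have h1 a : b a c + n a * be \in P.
  have := h a; rewrite rpredDl // prime_idealrM.
  by rewrite (negPf (unit_notin _ tu)).
have beP : be \in P.
  have [x [y xyP]] := ca_n2_notin C P.
  have : b x y * be \in P.
    have -> : b x y * be = b (x + y) c + n (x + y) * be
        - (b x c + n x * be) - (b y c + n y * be).
      by rewrite ca_n2Dl ca_nD; ring.
    by apply: rpredB; first apply: rpredB.
  by rewrite prime_idealrM (negPf xyP).
split=> // a; have := h1 a; rewrite rpredDr; last exact: idealMr.
by rewrite ca_n2C.
Qed.

Hypothesis gU : forall i, g i \is a GRing.unit.
Hypothesis hR : LG R.

(** Entry [k + 1] receives multiples of both other rows; each of the two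
    parameters alone already controls one off-diagonal entry of that row. *)
Lemma exists_unit_row (v : H) k : (forall y, exists z, U v z = y) ->
  exists a a', her_diag (transv_low G (k + 2) a' (transv_up G k a v)) (k + 1)
    \is a GRing.unit.
Proof.
move=> vsurj; have [m [e eP]] := ca_fin_gen C.
(* Generators of [C * C], so that one polynomial involves both parameters. *)
pose eL (i : 'I_(m + m)) := if split i is inl j then e j else 0.
pose eR (i : 'I_(m + m)) := if split i is inr j then e j else 0.
pose A (w : 'I_(m + m) -> R) := \sum_i w i *: eL i.
pose B (w : 'I_(m + m) -> R) := \sum_i w i *: eR i.
have AB a a' : exists w, A w = a /\ B w = a'.
  have [r ->] := eP a; have [s ->] := eP a'.
  exists (fun i => match split i with inl j => r j | inr j => s j end).
  have sl i : split (lshift m i : 'I_(m + m)) = inl i by apply: (unsplitK (inl i)).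
  have sr i : split (rshift m i : 'I_(m + m)) = inr i by apply: (unsplitK (inr i)).
  split; rewrite /A /B /eL /eR big_split_ord /=.
    rewrite [X in _ + X]big1 ?addr0 => [|i _]; last by rewrite sr scaler0.
    by apply: eq_bigr => i _; rewrite sl.
  rewrite big1 ?add0r => [|i _]; last by rewrite sl scaler0.
  by apply: eq_bigr => i _; rewrite sr.
pose f a a' := her_diag (transv_low G (k + 2) a' (transv_up G k a v)) (k + 1).
have fE a a' : f a a' = her_diag v (k + 1)
    + g (k + 1) * g (k + 2) * (b a (her_off v k) + n a * her_diag v (k + 2))
    + g k * g (k + 1) * (b a' (her_off v (k + 2))
       + g (k + 2) * b a' (conj (mul a (her_off v (k + 1)))) + n a' * her_diag v k).
  rewrite /f; have := transv_lowE G (k + 2) a' (transv_up G k a v).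
  by rewrite !I3E !transv_upE !ca_n2E => ->.
suff [w wu] : exists w, f (A w) (B w) \is a GRing.unit by exists (A w), (B w).
apply: LG_polyfun => // [|P].
  pose eC i := conj (mul (eL i) (her_off v (k + 1))).
  have EC w : conj (mul (A w) (her_off v (k + 1))) = \sum_i w i *: eC i.
    rewrite (big_morph (fun x => conj (mul x (her_off v (k + 1))))
      (id1 := 0) (op1 := +%R)).
    - by apply: eq_bigr => i _; rewrite ca_mulZl ca_barZ.
    - by move=> x y; rewrite ca_mulDl ca_barD.
    - by rewrite ca_mul0l ca_bar0.
  suff : polyfun (fun w => her_diag v (k + 1)
    + g (k + 1) * g (k + 2) * (b (A w) (her_off v k) + n (A w) * her_diag v (k + 2))
    + g k * g (k + 1) * (b (B w) (her_off v (k + 2))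
       + g (k + 2) * b (B w) (\sum_i w i *: eC i) + n (B w) * her_diag v k)).
    by move=> [p pE]; exists p => w; rewrite fE EC -pE.
  by repeat first [exact: polyfun_const | exact: polyfun_norm
    | exact: polyfun_polar | exact: polyfun_polarl
    | apply: polyfun_add | apply: polyfun_mul].
apply: contrapT => hP.
have fP a a' : f a a' \in P.
  have [w [<- <-]] := AB a a'; apply/negPn/negP => wP.
  by apply: hP; exists w.
(* Setting either parameter to zero leaves a quadratic function of the other. *)
have [||alP _ ckP] := @quad_coef_ideal P (her_diag v (k + 1)) (her_diag v (k + 2))
    (g (k + 1) * g (k + 2)) (her_off v k).
- by rewrite unitrM !gU.
- move=> a; have := fP a 0; rewrite fE !ca_n20l ca_n0 mulr0 mul0r !addr0 mulr0.
  by rewrite addr0.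
have [||_ _ cjP] := @quad_coef_ideal P (her_diag v (k + 1)) (her_diag v k)
    (g k * g (k + 1)) (her_off v (k + 2)).
- by rewrite unitrM !gU.
- move=> a; have := fP 0 a.
  rewrite fE ca_n20l ca_n0 mul0r addr0 mulr0 addr0.
  by rewrite ca_mul0l ca_bar0 ca_n20r mulr0 addr0.
by apply: (@row_not_in_prime P v (k + 1)); rewrite ?I3E.
Qed.

(** As in [exists_unit_row], but one off-diagonal entry of row [k + 1] is
    already zero, so a single transvection suffices. *)
Lemma exists_unit_block (v : H) k : (forall y, exists z, U v z = y) ->
    her_off v (k + 2) = 0 ->
  exists a, her_diag (transv_up G k a v) (k + 1) \is a GRing.unit.
Proof.
move=> vsurj c2; have [m [e eP]] := ca_fin_gen C.
pose A (w : 'I_m -> R) := \sum_i w i *: e i.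
suff [w wu] : exists w, her_diag v (k + 1)
    + g (k + 1) * g (k + 2) * (b (A w) (her_off v k) + n (A w) * her_diag v (k + 2))
    \is a GRing.unit.
  by exists (A w); rewrite transv_upE.
apply: LG_polyfun => // [|P].
  by repeat first [exact: polyfun_const | exact: polyfun_norm
    | exact: polyfun_polar | exact: polyfun_polarl
    | apply: polyfun_add | apply: polyfun_mul].
apply: contrapT => hP.
have [||alP _ ckP] := @quad_coef_ideal P (her_diag v (k + 1)) (her_diag v (k + 2))
    (g (k + 1) * g (k + 2)) (her_off v k).
- by rewrite unitrM !gU.
- move=> a; have [w ->] := eP a; apply/negPn/negP => wP.
  by apply: hP; exists w.
apply: (@row_not_in_prime P v (k + 1)); rewrite ?I3E //.
by move=> a; rewrite c2 ca_n20l rpred0.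
Qed.

(** The isotope at a diagonal [v] only changes [Gamma] to [Gamma v]. *)
Lemma diagonal_isotope_hermitian (v : H) k : (forall l, her_off v l = 0) ->
    her_diag v k \is a GRing.unit -> her_diag v (k + 1) \is a GRing.unit ->
  isotope_hermitian G v.
Proof.
move=> v0 d0U d1U e ve vsurj.
have Ud y l : her_diag (U v y) l = her_diag v l ^+ 2 * her_diag y l.
  rewrite her_U_diag her_crossE !her_sharp_diag her_sharp_off (her_TE G l) !v0.
  by rewrite !(ca_n0, ca_mulE, ca_bar0, scaler0) !ca_n2E !I3E; ring.
have Uo y l : her_off (U v y) l =
    (her_diag v (l + 1) * her_diag v (l + 2)) *: her_off y l.
  rewrite her_U_off her_crossE !her_sharp_diag !her_sharp_off !v0.
  apply: ca_eqP => w.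
  rewrite !(ca_n0, ca_bar_simpE, ca_mulE, scaler0, oppr0, addr0, add0r) !ca_n2E.
  by ring.
(* The third entry: [1] lies in the image of [U_v], which scales by squares. *)
have dU : forall l, her_diag v l \is a GRing.unit.
  apply: (I3_ind d0U d1U); have [z ez] := vsurj (her_one C).
  have := Ud z (k + 2); rewrite ez {1}/her_diag ffunE => e1.
  by move: (unitr1 R); rewrite e1 unitrM unitrX_pos // => /andP[].
(* The new diagonal absorbs the entries of [v]; the off-diagonal part of the
   module is left alone, and [rho] below is [U_v \o phi]. *)
pose d i := her_diag v i.
pose G' : 'M[R]_3 := diag_mx (\row_i (g i * d i)).
have G'E i : G' i i = g i * d i by rewrite !mxE eqxx mulr1n.
exists G'; split; first exact: diag_mx_is_diag.
  by move=> i; exists (g i * d i)^-1; rewrite G'E mulVr // unitrM gU dU.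
pose phi (x : H) : H :=
  ([ffun i => (d i)^-1 * her_diag x i], [ffun i => her_off x i]).
pose rho (x : H) : H := ([ffun i => d i * her_diag x i],
   [ffun i => (d (i + 1) * d (i + 2)) *: her_off x i]).
have phid x l : her_diag (phi x) l = (d l)^-1 * her_diag x l.
  by rewrite {1}/her_diag ffunE.
have phio x l : her_off (phi x) l = her_off x l by rewrite {1}/her_off ffunE.
have rhod x l : her_diag (rho x) l = d l * her_diag x l.
  by rewrite {1}/her_diag ffunE.
have rhoo x l : her_off (rho x) l = (d (l + 1) * d (l + 2)) *: her_off x l.
  by rewrite {1}/her_off ffunE.
have phiL : linear phi.
  move=> t x y; apply: (her_eqP (k := k)) => l _.
    by rewrite !(her_linE, phid); ring.
  by rewrite !(her_linE, phio).
have rhoL : linear rho.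
  move=> t x y; apply: (her_eqP (k := k)) => l _.
    by rewrite !(her_linE, rhod); ring.
  by apply: ca_eqP => w; rewrite !(her_linE, rhoo) !ca_n2E; ring.
have dVd l : (d l)^-1 * d l = 1 by rewrite mulVr // dU.
pose D := d k * d (k + 1) * d (k + 2).
have DE l : D = d l * d (l + 1) * d (l + 2).
  by case: (I3_cases k l) => ->; rewrite ?I3E /D; ring.
have DU : D \is a GRing.unit by rewrite !unitrM !dU.
have hZd t (x : H) l : her_diag (t *: x) l = t * her_diag x l.
  by rewrite /her_diag /= ffunE.
have hZo t (x : H) l : her_off (t *: x) l = t *: her_off x l.
  by rewrite /her_off /= ffunE.
have phiU : forall x y, U (phi x) (rho y) = phi (@ua_U R (Her3 C G') x y).
  apply: (@her_U_similarity _ _ _ _ phi rho D D^-1) => // [|x y|x|x].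
  - by rewrite mulVr.
  - rewrite !(her_TE _ k) !phid !phio !rhod !rhoo !ca_n2E !G'E !I3E.
    have E l t s : (d l)^-1 * t * (d l * s) = t * s.
      by rewrite mulrACA dVd mul1r.
    by rewrite !E; ring.
  - apply: (her_eqP (k := k)) => l _.
      rewrite hZd !her_sharp_diag !phid phio rhod her_sharp_diag !G'E (DE l).
      transitivity (d l * ((((d (l + 1))^-1 * d (l + 1))
          * ((d (l + 2))^-1 * d (l + 2))) * (her_diag x (l + 1) * her_diag x (l + 2))
        - g (l + 1) * d (l + 1) * (g (l + 2) * d (l + 2)) * n (her_off x l))).
        by ring.
      by rewrite !dVd !mul1r.
    rewrite hZo !her_sharp_off phid !phio rhoo her_sharp_off !G'E (DE l).
    apply: ca_eqP => w; rewrite !ca_n2E; set X := b (conj _) w; set Y := b _ w.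
    transitivity (d (l + 1) * d (l + 2) * (- ((d l)^-1 * d l * her_diag x l * Y)
      + g l * d l * X)); first by ring.
    by rewrite dVd; ring.
  - apply: (her_eqP (k := k)) => l _.
      rewrite hZd !her_sharp_diag phid !rhod rhoo her_sharp_diag !G'E (DE l) ca_nZ.
      transitivity ((d l)^-1 * d l * (d (l + 1) * d (l + 2)
        * (her_diag x (l + 1) * her_diag x (l + 2)
           - g (l + 1) * d (l + 1) * (g (l + 2) * d (l + 2)) * n (her_off x l)))).
        by rewrite dVd; ring.
      by ring.
    rewrite hZo !her_sharp_off phio !rhoo rhod her_sharp_off !G'E (DE l).
    apply: ca_eqP => w; rewrite !(ca_mulE, ca_bar_simpE) !ca_n2E !I3E.
    by ring.
have rhoE y : rho y = U v (phi y).
  apply: (her_eqP (k := k)) => l _.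
    by rewrite rhod Ud phid expr2 -!mulrA [_ * (_^-1 * _)]mulrA mulrV ?dU // mul1r.
  by rewrite rhoo Uo phio.
apply/isomorphic_sym/(@isomorphic_intro _ (Her3 C G') (her_isotope G v e) phi).
- exact: phiL.
- exists (fun x : H =>
      ([ffun i => d i * her_diag x i], [ffun i => her_off x i]) : H) => x.
    apply: (her_eqP (k := k)) => l _.
      by rewrite {1}/her_diag ffunE phid mulrA mulrV ?dU // mul1r.
    by rewrite {1}/her_off ffunE phio.
  apply: (her_eqP (k := k)) => l _; last by rewrite phio {1}/her_off ffunE.
  by rewrite phid {1}/her_diag ffunE mulrA dVd mul1r.
- apply: (her_eqP (k := k)) => l _.
    rewrite phid {1}/her_diag ffunE mulr1.
    have := Ud e l; rewrite ve => h.
    apply: (mulrI (dU l)); rewrite mulrV ?dU //; apply: (mulrI (dU l)).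
    by rewrite mulr1 mulrA -expr2 -h.
  rewrite phio {1}/her_off ffunE; have := Uo e l; rewrite ve v0 => h.
  have dd : d (l + 1) * d (l + 2) \is a GRing.unit by rewrite unitrM !dU.
  by rewrite -[RHS]scale1r -(mulVr dd) -scalerA -h scaler0.
move=> x y.
by rewrite -[RHS]/(U (phi x) (U v (phi y))) -rhoE phiU.
Qed.

Lemma block_isotope_hermitian (v : H) k : her_diag v k \is a GRing.unit ->
    her_off v (k + 1) = 0 -> her_off v (k + 2) = 0 ->
  isotope_hermitian G v.
Proof.
move=> d0U c1 c2 e ve vsurj.
have [a] := exists_unit_block vsurj c2.
set v1 := transv_up G k a v => d1U.
have c11 : her_off v1 (k + 1) = 0 by rewrite transv_upE.
have c12 : her_off v1 (k + 2) = 0.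
  by rewrite transv_upE c1 c2 ca_mul0r ca_bar0 scaler0 addr0.
apply: (@isotope_hermitian_transv_up _ _ G k a _ _ e) => //.
pose a' := - (her_diag v1 (k + 1))^-1 *: her_off v1 k.
apply: (@isotope_hermitian_transv_low _ _ G k a').
apply: (@diagonal_isotope_hermitian _ k); rewrite ?transv_lowE //;
  last by rewrite transv_upE.
apply: (@I3_ind (fun l => her_off _ l = 0) k); rewrite transv_lowE //.
  by rewrite scalerA mulrN mulrV // scaleN1r addrN.
by rewrite c11 c12 ca_mul0l ca_bar0 scaler0 addr0.
Qed.

(** The unit is a pivot: two transvections from row [k] clear the rest of that
    row. *)
Lemma unit_row_isotope_hermitian (v : H) k : her_diag v k \is a GRing.unit ->
  isotope_hermitian G v.
Proof.
move=> dU.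
pose a := - (her_diag v k)^-1 *: her_off v (k + 2).
have := transv_lowE G (k + 2) a v; rewrite !I3E; set v1 := transv_low _ _ _ _ => v1E.
pose a' := - (her_diag v k)^-1 *: her_off v1 (k + 1).
have := transv_upE G (k + 1) a' v1; rewrite !I3E; set v2 := transv_up _ _ _ _ => v2E.
have c2 : her_off v1 (k + 2) = 0.
  by rewrite v1E scalerA mulrN mulrV // scaleN1r addrN.
have d1 : her_diag v1 k = her_diag v k by rewrite v1E.
apply: (@isotope_hermitian_transv_low _ _ G (k + 2) a); rewrite -/v1.
apply: (@isotope_hermitian_transv_up _ _ G (k + 1) a'); rewrite -/v2.
apply: (@block_isotope_hermitian _ k); rewrite v2E ?d1 //.
by rewrite scalerA mulrN mulrV // scaleN1r addrN.
Qed.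

Lemma all_isotopes_hermitian (v : H) : isotope_hermitian G v.
Proof.
move=> e ve vsurj; have [a [a' dU]] := exists_unit_row 0 vsurj.
apply: (@isotope_hermitian_transv_up _ _ G 0 a _ _ e) => //.
apply: (@isotope_hermitian_transv_low _ _ G (0 + 2) a').
by apply: unit_row_isotope_hermitian dU.
Qed.

End Diagonalization.

(** * From a Jordan algebra to a hermitian isotope *)

Section JordanToHermitian.
Variables (R : comNzRingType).

Lemma jordan_fundamental (J : paraQuad R) : jordan J -> forall x y z : J,
  ua_U (ua_U x y) z = ua_U x (ua_U y (ua_U x z)).
Proof.
move=> hJ x y z.
have UE (w : J) : pq_U J R^o (tens w 1) = tens (law_map (pq_U J) w) 1.
  exact: tensor_unitE.
have actE (f : Endo (pq_mod J)) (w : J) :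
    tact (tens f (1 : R^o)) (tens w 1) = tens (f w) 1.
  by rewrite tact_tens; congr tens; apply: mulr1.
have [+ _] := hJ R^o (tens x 1) (tens y 1) (tens z 1).
rewrite !UE !actE !UE !actE => /(congr1 (@tunit R (pq_mod J))).
by rewrite !tunit_tens !scale1r.
Qed.

(** An isotope of an isotope is an isotope, so the isotopy from [J] to
    [Her_3(C, G)] can be read backwards. *)
Lemma jordan_her_isotope (J : paraQuad R) (C : compAlg R) (G : 'M[R]_3) :
    jordan J -> isotopic J (Her3 C G) ->
  exists v e : her_mod C, [/\ @ua_U R (Her3 C G) v e = v,
    forall y, exists z, @ua_U R (Her3 C G) v z = y
    & isomorphic J (her_isotope G v e)].
Proof.
move=> hJ [u [[W UK WK] [f [[h fK hK] f1 fU]]]].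
have UU := jordan_fundamental hJ.
have U1 (x : J) : ua_U (ua_one J) x = x by apply: pq_U1.
pose u' : J := ua_inv u.
have uu' : ua_U u u' = u.
  rewrite /u' /ua_inv; case: pselect => [ex|[]]; first by case: cid.
  by exists (W u).
(* [U_u = U_(U_u u') = U_u U_u' U_u], so [U_u'] inverts [U_u]. *)
have u'E x : ua_U u' x = W x.
  rewrite -[x in LHS](WK x); apply: (can_inj UK).
  by rewrite -UU uu'.
(* In [J^(u)] one has [U_v^(u) = U_u^-1], so passing to the isotope at [v]
   undoes the isotope at [u]. *)
pose v : J := ua_U u' (ua_one J).
have vE x : ua_U v x = W (W x) by rewrite UU U1 !u'E.
have hU (x y : J) : @ua_U R (Her3 C G) (h x) (h y) = h (@ua_U R J x (ua_U u y)).
  by apply: (can_inj fK); rewrite fU !hK.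
exists (h v), (h (ua_one J)); split.
- by rewrite hU vE UK /v u'E.
- by move=> y; exists (h (@ua_U R J u (f y))); rewrite hU vE UK UK fK.
apply: isomorphic_sym.
apply: (@isomorphic_intro _ (her_isotope G (h v) (h (ua_one J))) J f).
- by move=> t x y; rewrite linearP.
- by exists h.
- by rewrite hK.
move=> x y; rewrite -{1}[x]fK -{1}[y]fK.
rewrite -[LHS]/(f (@ua_U R (Her3 C G) (h (f x)) (ua_U (h v) (h (f y))))).
by rewrite hU vE UK hU WK hK.
Qed.
End JordanToHermitian.

Theorem theorem13p5 (R : comUnitRingType) (J : paraQuad R) (hJ : jordan J)
    (C : compAlg R) (Gamma : 'M[R]_3) (Gdiag : is_diag_mx Gamma)
    (Gunit : Gamma \in unitmx) (hiso : isotopic J (Her3 C Gamma)) (hR : LG R) :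
  exists Gamma' : 'M[R]_3,
    [/\ is_diag_mx Gamma', Gamma' \in unitmx & isomorphic J (Her3 C Gamma')].
Proof.
have diagU (G : 'M[R]_3) : is_diag_mx G ->
    (G \in unitmx) = [forall i, G i i \is a GRing.unit].
  move=> /is_diag_mxP Gd.
  have GE : G = diag_mx (\row_i G i i).
    apply/matrixP => i j; rewrite !mxE; have [->|ne] := eqVneq i j.
      by rewrite mulr1n.
    by rewrite mulr0n Gd.
  rewrite unitmxE {1}GE det_diag; under eq_bigr do rewrite mxE.
  apply/unitr_prodP/forallP => GU i; last by [].
  by apply: GU; rewrite ?mem_index_enum.
have /forallP gU : [forall i, Gamma i i \is a GRing.unit] by rewrite -diagU.
have [v [e [ve vsurj iso]]] := jordan_her_isotope hJ hiso.
have [G' [G'd G'u iso']] := all_isotopes_hermitian gU hR ve vsurj.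
exists G'; split; [exact: G'd | | exact: isomorphic_trans iso iso'].
rewrite diagU //; apply/forallP => i; have [t tE] := G'u i.
by apply/unitrPr; exists t; rewrite mulrC.
Qed.
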